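(* Let $E$ and $F$ be Banach spaces. Suppose $E^*$ does not have the Schur property, $F^*$ contains a copy of $\ell_1$, and $\mathcal{L}(E^*,F^{**})=\mathcal{L}_{\mathrm{cc}}(E^*,F^{**})$ (that is, every bounded linear operator from $E^*$ into $F^{**}$ is completely continuous). Then $(E\widehat{\otimes}_\epsilon F)^*$ does not have the Dunford-Pettis property.
   Context: $E\widehat{\otimes}_\epsilon F$ is the (completed) injective tensor product of $E$ and $F$. $E^*$, $E^{**}$ denote the dual and bidual of $E$. An operator is a bounded linear map; $\mathcal{L}(E,F)$ is the space of all operators from $E$ into $F$. An operator is completely continuous if it takes weak Cauchy sequences into norm Cauchy sequences; $\mathcal{L}_{\mathrm{cc}}(E,F)$ is the space of completely continuous operators from $E$ into $F$. A Banach space $E$ has the Dunford-Pettis property if every weakly compact operator from $E$ into any Banach space is completely continuous; equivalently, $\lim_n\phi_n(x_n)=0$ for all weakly null sequences $(x_n)\subset E$ and $(\phi_n)\subset E^*$. A Banach space has the Schur property if every weakly convergent sequence in it converges in norm. ''Contains a copy of $\ell_1$'' means having a closed subspace isomorphic (linearly homeomorphic) to $\ell_1$. *)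

(* Defs.v *)
From HB Require Import structures.
From mathcomp Require Import all_boot all_order all_algebra.
From mathcomp Require Import complex.
From mathcomp Require Import all_classical all_reals all_analysis.

Set Implicit Arguments.
Unset Strict Implicit.
Unset Printing Implicit Defensive.

Import Order.TTheory GRing.Theory Num.Theory.
Import numFieldNormedType.Exports.

Local Open Scope classical_set_scope.
Local Open Scope ring_scope.

(* A Banach space is a [completeNormedModType (scalars R k)], for real or for
   complex scalars according to [k]. *)
Variant scalar_kind := RealScalars | ComplexScalars.

Definition scalars (R : realType) (k : scalar_kind) : numFieldType :=
  match k with
  | RealScalars => R
  | ComplexScalars => R[i]%C
  end.

Definition scalar_re (R : realType) (k : scalar_kind) : scalars R k -> R :=
  match k return scalars R k -> R with
  | RealScalars => id
  | ComplexScalars => @complex.Re R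
  end.

Definition scalar_of_real (R : realType) (k : scalar_kind) : R -> scalars R k :=
  match k return R -> scalars R k with
  | RealScalars => id
  | ComplexScalars => real_complex R
  end.

(* The norm of a normed module over [scalars R k] takes its values in
   [scalars R k]; [rnorm] is the same norm, seen as a real number. *)
Definition rnorm (R : realType) (k : scalar_kind)
    (E : normedModType (scalars R k)) (x : E) : R := scalar_re `|x|.

Section ScalarTheory.
Context {R : realType} {k : scalar_kind}.
Local Notation K := (scalars R k).
Local Notation inj := (@scalar_of_real R k).

Lemma scalar_of_realD : {morph inj : x y / x + y}.
Proof. by rewrite /scalar_of_real; case: k => // x y; rewrite rmorphD. Qed.

Lemma scalar_of_realM : {morph inj : x y / x * y}.
Proof. by rewrite /scalar_of_real; case: k => // x y; rewrite rmorphM. Qed.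

Lemma scalar_of_real0 : inj 0 = 0.
Proof. by rewrite /scalar_of_real; case: k => //; rewrite rmorph0. Qed.

Lemma scalar_of_real1 : inj 1 = 1.
Proof. by rewrite /scalar_of_real; case: k => //; rewrite rmorph1. Qed.

Lemma ler_scalar_of_real : {mono inj : x y / x <= y}.
Proof. by rewrite /scalar_of_real; case: k => // x y; exact: lecR. Qed.

Lemma ltr_scalar_of_real : {mono inj : x y / x < y}.
Proof. by apply: leW_mono; exact: ler_scalar_of_real. Qed.

Lemma scalar_of_realK : cancel inj (@scalar_re R k).
Proof. by rewrite /scalar_of_real /scalar_re; case: k. Qed.

Lemma scalar_reK (a : K) : 0 <= a -> inj (scalar_re a) = a.
Proof.
rewrite /scalar_of_real /scalar_re; case: k a => // a a0.
exact/RRe_real/ger0_real.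
Qed.

Lemma rnormE (E : normedModType K) (x : E) : inj (rnorm x) = `|x|.
Proof. exact: scalar_reK. Qed.

Lemma rnorm_ge0 (E : normedModType K) (x : E) : 0 <= rnorm x.
Proof. by rewrite -ler_scalar_of_real rnormE scalar_of_real0. Qed.

Lemma ler_rnormD (E : normedModType K) (x y : E) :
  rnorm (x + y) <= rnorm x + rnorm y.
Proof. by rewrite -ler_scalar_of_real scalar_of_realD !rnormE ler_normD. Qed.

Lemma rnormZ (E : normedModType K) (a : K) (x : E) :
  rnorm (a *: x) = rnorm a * rnorm x.
Proof.
by apply: (can_inj scalar_of_realK); rewrite scalar_of_realM !rnormE normrZ.
Qed.

Lemma rnorm0_eq0 (E : normedModType K) (x : E) : rnorm x = 0 -> x = 0.
Proof.
by move=> x0; apply: normr0_eq0; rewrite -rnormE x0 scalar_of_real0.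
Qed.

Lemma rnorm0 (E : normedModType K) : rnorm (0 : E) = 0.
Proof.
by apply: (can_inj scalar_of_realK); rewrite rnormE normr0 scalar_of_real0.
Qed.

Lemma rnorm_of_real (r : R) : 0 <= r -> rnorm (inj r : K) = r.
Proof.
move=> r0; apply: (can_inj scalar_of_realK); rewrite rnormE ger0_norm//.
by rewrite -scalar_of_real0 ler_scalar_of_real.
Qed.

End ScalarTheory.

Section Operators.
Context {R : realType} {k : scalar_kind}.
Local Notation K := (scalars R k).
Variables E F : normedModType K.

Definition bounded_linear : {pred E -> F} := fun f =>
  `[< linear f /\ exists M : R, forall x, rnorm (f x) <= M * rnorm x >].

Record operator := Operator {
  operator_fun :> E -> F;
  operatorP : operator_fun \in bounded_linear }.

HB.instance Definition _ := [isSub for operator_fun].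
HB.instance Definition _ := [Choice of operator by <:].

Lemma bounded_linear_submod : submod_closed bounded_linear.
Proof.
split.
  apply/asboolP; split.
    by move=> a x y; rewrite -[RHS]/(a *: (0 : F) + 0) scaler0 addr0.
  by exists 0 => x; rewrite rnorm0 mul0r.
move=> a f g /asboolP[lf [M fM]] /asboolP[lg [N gN]]; apply/asboolP; split.
  move=> b x y; rewrite !fctE lf lg !scalerDr !scalerA (mulrC a b).
  by rewrite -!addrA; congr (_ + _); rewrite addrCA.
exists (rnorm a * M + N) => x; rewrite !fctE (le_trans (ler_rnormD _ _))//.
by rewrite rnormZ mulrDl -mulrA lerD// ler_wpM2l// rnorm_ge0.
Qed.

HB.instance Definition _ :=
  GRing.isSubmodClosed.Build K (E -> F) bounded_linear bounded_linear_submod.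
HB.instance Definition _ := [SubChoice_isSubLmodule of operator by <:].


Implicit Types f g : operator.

Lemma operator_linear f : linear f.
Proof. by have /asboolP[] := operatorP f. Qed.

HB.instance Definition _ f :=
  GRing.isLinear.Build K E F *:%R (f : E -> F) (operator_linear f).

Lemma operator_bounded f : exists M : R, forall x, rnorm (f x) <= M * rnorm x.
Proof. by have /asboolP[] := operatorP f. Qed.

Lemma operatorPE (f g : operator) : f = g <-> forall x, f x = g x.
Proof. by split => [->//|fg]; apply/val_inj/funext. Qed.

Lemma operatorDE f g x : (f + g) x = f x + g x. Proof. by []. Qed.

Lemma operatorZE a f x : (a *: f) x = a *: f x. Proof. by []. Qed.

Lemma operator0E x : (0 : operator) x = 0. Proof. by []. Qed.

Lemma operator_sumE (I : Type) (s : seq I) (P : pred I) (T : I -> operator) x :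
  (\sum_(i <- s | P i) T i) x = \sum_(i <- s | P i) T i x.
Proof.
by elim/big_ind2: _ => // f u g v <- <-; rewrite operatorDE.
Qed.

Definition operator_norm f : R :=
  sup [set rnorm (f x) | x in [set x | rnorm x <= 1]].

Lemma operator_norm_has_sup f :
  has_sup [set rnorm (f x) | x in [set x | rnorm x <= 1]].
Proof.
split; first by exists (rnorm (f 0)), 0 => //=; rewrite rnorm0.
have [M fM] := operator_bounded f; exists `|M| => _ [x /= x1 <-].
rewrite (le_trans (fM x))// (le_trans (ler_wpM2r (rnorm_ge0 _) (ler_norm M)))//.
by rewrite ler_piMr.
Qed.

Lemma operator_norm_ge0 f : 0 <= operator_norm f.
Proof.
rewrite (le_trans (rnorm_ge0 (f 0)))//.
apply: sup_upper_bound; first exact: operator_norm_has_sup.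
by exists 0; rewrite //= rnorm0.
Qed.

Lemma ler_operator_norm f x : rnorm (f x) <= operator_norm f * rnorm x.
Proof.
have [->|x0] := eqVneq x 0; first by rewrite linear0 !rnorm0 mulr0.
have nx0 : 0 < rnorm x.
  rewrite lt_neqAle rnorm_ge0 andbT eq_sym.
  by apply: contra x0 => /eqP/rnorm0_eq0/eqP.
pose y := @scalar_of_real R k (rnorm x)^-1 *: x.
rewrite -ler_pdivrMr// mulrC -(@rnorm_of_real _ k (rnorm x)^-1); last first.
  by rewrite invr_ge0 ltW.
rewrite -rnormZ -linearZ -/y.
apply: sup_upper_bound; first exact: operator_norm_has_sup.
exists y; last by [].
by rewrite /= rnormZ rnorm_of_real ?invr_ge0 ?(ltW nx0)// mulVf ?gt_eqF.
Qed.

Lemma operator_norm_le f (M : R) : 0 <= M ->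
  (forall x, rnorm (f x) <= M * rnorm x) -> operator_norm f <= M.
Proof.
move=> M0 fM; apply: ge_sup; first by have [] := operator_norm_has_sup f.
by move=> _ [x /= x1 <-]; rewrite (le_trans (fM x))// ler_piMr.
Qed.

Let operator_normD f g :
  @scalar_of_real R k (operator_norm (f + g)) <=
  @scalar_of_real R k (operator_norm f) + @scalar_of_real R k (operator_norm g).
Proof.
rewrite -scalar_of_realD ler_scalar_of_real; apply: operator_norm_le.
  by rewrite addr_ge0 ?operator_norm_ge0.
move=> x; rewrite operatorDE (le_trans (ler_rnormD _ _))// mulrDl.
by rewrite lerD// ler_operator_norm.
Qed.

Let operator_normZ (a : K) f :
  @scalar_of_real R k (operator_norm (a *: f)) =
  `|a| * @scalar_of_real R k (operator_norm f).
Proof.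
rewrite -(rnormE a) -scalar_of_realM; congr (scalar_of_real _ _).
have le b g : operator_norm (b *: g) <= rnorm b * operator_norm g.
  apply: operator_norm_le => [|x].
    by rewrite mulr_ge0 ?rnorm_ge0 ?operator_norm_ge0.
  by rewrite operatorZE rnormZ -mulrA ler_wpM2l ?rnorm_ge0// ler_operator_norm.
apply/eqP; rewrite eq_le le/=; have [->|a0] := eqVneq a 0.
  by rewrite rnorm0 mul0r operator_norm_ge0.
have na0 : 0 < rnorm a.
  rewrite lt_neqAle rnorm_ge0 andbT eq_sym.
  by apply: contra a0 => /eqP/rnorm0_eq0/eqP.
rewrite mulrC -ler_pdivlMr//.
have := le a^-1 (a *: f); rewrite scalerA mulVf// scale1r => /le_trans; apply.
rewrite mulrC ler_wpM2l ?operator_norm_ge0//.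
rewrite -(@ler_pM2r _ (rnorm a))// mulVf ?gt_eqF//.
rewrite -[leLHS]/(rnorm (a^-1 : K) * rnorm (a : K)) -rnormZ /GRing.scale/= mulVf//.
by rewrite -(@ler_scalar_of_real R k) rnormE normr1 scalar_of_real1.
Qed.

Let operator_norm0_eq0 f : @scalar_of_real R k (operator_norm f) = 0 -> f = 0.
Proof.
rewrite -scalar_of_real0 => /(can_inj (@scalar_of_realK R k)) f0.
apply/operatorPE => x; apply/rnorm0_eq0/eqP; rewrite eq_le rnorm_ge0 andbT.
by rewrite (le_trans (ler_operator_norm f x))// f0 mul0r.
Qed.

HB.instance Definition _ := Lmodule_isNormed.Build K operator
  operator_normD operator_normZ operator_norm0_eq0.

Lemma rnorm_operatorE f : rnorm f = operator_norm f.
Proof. exact: scalar_of_realK. Qed.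

End Operators.


Arguments bounded_linear {R k} E F.

Notation dual E := (operator E (scalars _ _)).

Section Dual.
Context {R : realType} {k : scalar_kind}.
Local Notation K := (scalars R k).

Lemma evaluation_bounded_linear (E : normedModType K) (x : E) :
  (fun phi : dual E => phi x : K) \in bounded_linear (dual E) K.
Proof.
apply/asboolP; split; first by [].
by exists (rnorm x) => phi; rewrite mulrC rnorm_operatorE ler_operator_norm.
Qed.

Definition evaluation (E : normedModType K) (x : E) : dual (dual E) :=
  Operator (evaluation_bounded_linear x).

End Dual.

Section InjectiveTensorProduct.
Context {R : realType} {k : scalar_kind}.
Local Notation K := (scalars R k).
Variables E F : normedModType K.

Lemma elementary_tensor_bounded_linear (x : E) (y : F) :
  (fun phi : dual E => (phi x : K) *: evaluation y)
    \in bounded_linear (dual E) (dual (dual F)).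
Proof.
apply/asboolP; split => [a phi psi|].
  by rewrite operatorDE operatorZE scalerDl scalerA.
exists (rnorm x * rnorm (evaluation y)) => phi.
rewrite rnormZ mulrAC ler_wpM2r ?rnorm_ge0// mulrC rnorm_operatorE.
exact: ler_operator_norm.
Qed.

Definition elementary_tensor (x : E) (y : F) :
    operator (dual E) (dual (dual F)) :=
  Operator (elementary_tensor_bounded_linear x y).

(* The bounded bilinear forms on E^* x F^*, in curried form, are the operators
   from E^* to F^**. The algebraic tensor product of E and F embeds in this
   Banach space: x (x) y goes to (phi, psi) |-> phi x * psi y, and the norm
   induced on finite sums is the injective norm (see
   [injective_norm_finite_tensor]). The completed injective tensor product is
   thus the closure of the finite sums. *)
Definition finite_tensor (s : seq (E * F)) : operator (dual E) (dual (dual F)) :=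
  \sum_(p <- s) elementary_tensor p.1 p.2.

Definition injective_tensor : {pred operator (dual E) (dual (dual F))} :=
  fun u => `[< closure (range finite_tensor) u >].

Record injective_tensor_product := InjectiveTensor {
  bilinear_form_of :> operator (dual E) (dual (dual F));
  injective_tensorP : bilinear_form_of \in injective_tensor }.

HB.instance Definition _ := [isSub for bilinear_form_of].
HB.instance Definition _ := [Choice of injective_tensor_product by <:].

Lemma injective_tensor_approx u : u \in injective_tensor <->
  forall e : R, 0 < e -> exists s, rnorm (u - finite_tensor s) < e.
Proof.
split=> [/asboolP cu e e0|ue].
  have e'0 : 0 < @scalar_of_real R k e.
    by rewrite -(@scalar_of_real0 R k) ltr_scalar_of_real.
  have [_ [[s _ <-]]] := cu _ (nbhsx_ballx u _ e'0).
  rewrite -ball_normE /= => us; exists s.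
  by rewrite -(@ltr_scalar_of_real R k) rnormE.
apply/asboolP => B /nbhs_ballP[e /= e0]; rewrite -ball_normE => eB.
have re0 : 0 < scalar_re e.
  by rewrite -(@ltr_scalar_of_real R k) scalar_of_real0 scalar_reK// ltW.
have [s us] := ue _ re0; exists (finite_tensor s); split; first by exists s.
by apply: eB; rewrite /= -rnormE -(scalar_reK (ltW e0)) ltr_scalar_of_real.
Qed.

Lemma injective_tensor_submod : submod_closed injective_tensor.
Proof.
have fD s t : finite_tensor (s ++ t) = finite_tensor s + finite_tensor t.
  by rewrite /finite_tensor big_cat.
have fZ (a : K) s :
    finite_tensor [seq (a *: p.1, p.2) | p <- s] = a *: finite_tensor s.
  rewrite /finite_tensor big_map scaler_sumr; apply: eq_bigr => p _.
  by apply/operatorPE => phi; rewrite operatorZE /= linearZ/= -scalerA.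
split.
  apply/injective_tensor_approx => e e0; exists [::].
  by rewrite /finite_tensor big_nil subrr rnorm0.
move=> a u v /injective_tensor_approx ua /injective_tensor_approx va.
apply/injective_tensor_approx => e e0.
have a0 : 0 < rnorm a + 1 by rewrite ltr_wpDl ?rnorm_ge0.
have [s us] := ua (e / 2 / (rnorm a + 1)) ltac:(by rewrite !divr_gt0).
have [t vt] := va (e / 2) ltac:(by rewrite divr_gt0).
exists ([seq (a *: p.1, p.2) | p <- s] ++ t); rewrite fD fZ.
rewrite opprD addrACA -scalerBr (le_lt_trans (ler_rnormD _ _))//.
rewrite [ltRHS](splitr e) ler_ltD// rnormZ.
rewrite ltr_pdivlMr// in us.
rewrite mulrC (le_trans _ (ltW us))// ler_wpM2l ?rnorm_ge0//.
by rewrite lerDl.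
Qed.

HB.instance Definition _ := GRing.isSubmodClosed.Build K
  (operator (dual E) (dual (dual F))) injective_tensor injective_tensor_submod.
HB.instance Definition _ :=
  [SubChoice_isSubLmodule of injective_tensor_product by <:].

Let norm (u : injective_tensor_product) : K := `|bilinear_form_of u|.

Let normD u v : norm (u + v) <= norm u + norm v.
Proof. exact: ler_normD. Qed.

Let normZ (a : K) u : norm (a *: u) = `|a| * norm u.
Proof. exact: normrZ. Qed.

Let norm0_eq0 u : norm u = 0 -> u = 0.
Proof. by move=> u0; apply/val_inj/normr0_eq0. Qed.

HB.instance Definition _ := Lmodule_isNormed.Build K injective_tensor_product
  normD normZ norm0_eq0.

Lemma injective_norm_finite_tensor (s : seq (E * F)) :
  rnorm (finite_tensor s) =
  sup [set rnorm (\sum_(p <- s) phi.1 p.1 * phi.2 p.2 : K) |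
    phi in [set phi : dual E * dual F | rnorm phi.1 <= 1 /\ rnorm phi.2 <= 1]].
Proof.
have sE phi psi : finite_tensor s phi psi = \sum_(p <- s) phi p.1 * psi p.2.
  rewrite /finite_tensor !operator_sumE; exact: eq_bigr.
set A := [set _ | _ in _].
have nA : A !=set0.
  by eexists; exists (0, 0) => //=; rewrite !rnorm0.
have ubA : ubound A (rnorm (finite_tensor s)).
  move=> _ [[phi psi] /= [phi1 psi1] <-]; rewrite -sE.
  rewrite (le_trans (ler_operator_norm _ _))// -rnorm_operatorE.
  rewrite (le_trans (ler_piMr _ psi1)) ?rnorm_ge0//.
  rewrite (le_trans (ler_operator_norm _ _))// -rnorm_operatorE.
  by rewrite ler_piMr ?rnorm_ge0.
apply/eqP; rewrite eq_le; apply/andP; split; last exact: ge_sup.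
rewrite rnorm_operatorE; apply: ge_sup.
  by have [] := operator_norm_has_sup (finite_tensor s).
move=> _ [phi /= phi1 <-]; rewrite rnorm_operatorE; apply: ge_sup.
  by have [] := operator_norm_has_sup (finite_tensor s phi).
move=> _ [psi /= psi1 <-]; apply: sup_upper_bound.
  by split; [exact: nA|exists (rnorm (finite_tensor s))].
by exists (phi, psi); rewrite // sE.
Qed.

End InjectiveTensorProduct.
Arguments injective_tensor {R k} E F.
Arguments bilinear_form_of {R k E F}.

Section Ell1.
Context (R : realType) (k : scalar_kind).
Local Notation K := (scalars R k).
Local Notation abs a := (rnorm (a : K)).

Definition summable_seq : {pred nat -> K} := fun a =>
  `[< cvgn (series (fun n => abs (a n))) >].

Record ell1 := Ell1 { ell1_seq :> nat -> K; ell1P : ell1_seq \in summable_seq }.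

HB.instance Definition _ := [isSub for ell1_seq].
HB.instance Definition _ := [Choice of ell1 by <:].

Lemma summable_seq_submod : submod_closed summable_seq.
Proof.
split.
  apply/asboolP; rewrite (_ : series _ = cst 0); first exact: is_cvg_cst.
  by apply/funext => n; rewrite seriesEnat/= big1// => i _; exact: rnorm0.
move=> c a b /asboolP ca /asboolP cb; apply/asboolP.
apply: (@series_le_cvg _ _ (fun n => abs c * abs (a n) + abs (b n))).
- by move=> n; exact: rnorm_ge0.
- by move=> n; rewrite addr_ge0 ?mulr_ge0 ?rnorm_ge0.
- by move=> n; rewrite (le_trans (ler_rnormD _ _))// rnormZ.
- exact: is_cvg_seriesD (is_cvg_seriesZ (k := abs c) ca) cb.
Qed.

HB.instance Definition _ :=
  GRing.isSubmodClosed.Build K (nat -> K) summable_seq summable_seq_submod.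
HB.instance Definition _ := [SubChoice_isSubLmodule of ell1 by <:].

Definition ell1_norm (a : ell1) : R := limn (series (fun n => abs (a n))).

Let norm (a : ell1) : K := scalar_of_real k (ell1_norm a).

Lemma ell1_cvg (a : ell1) : cvgn (series (fun n => abs (a n))).
Proof. by have /asboolP := ell1P a. Qed.

Let normD a b : norm (a + b) <= norm a + norm b.
Proof.
rewrite -scalar_of_realD ler_scalar_of_real /ell1_norm.
rewrite -lim_seriesD; [|exact: ell1_cvg..].
apply: lim_series_le => [||n]; [exact: ell1_cvg| |exact: ler_rnormD].
by apply: is_cvg_seriesD; exact: ell1_cvg.
Qed.

Let normZ (c : K) a : norm (c *: a) = `|c| * norm a.
Proof.
rewrite -(rnormE c) -scalar_of_realM; congr scalar_of_real.
rewrite /ell1_norm -[RHS](lim_seriesZ (abs c) (@ell1_cvg a)).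
by congr (limn (series _)); apply/funext => n; rewrite rnormZ.
Qed.

Let norm0_eq0 a : norm a = 0 -> a = 0.
Proof.
rewrite -(@scalar_of_real0 R k) => /(can_inj (@scalar_of_realK R k)) a0.
apply/val_inj/funext => n; apply/rnorm0_eq0/eqP.
rewrite eq_le rnorm_ge0 andbT -a0 /ell1_norm.
have nd : nondecreasing_seq (series (fun n => abs (a n))).
  by apply: nondecreasing_series => m _ _; exact: rnorm_ge0.
apply: le_trans (nondecreasing_cvgn_le nd (@ell1_cvg a) n.+1).
rewrite seriesEord /= big_ord_recr lerDr sumr_ge0// => m _.
exact: (@rnorm_ge0 R k K).
Qed.

HB.instance Definition _ := Lmodule_isNormed.Build K ell1 normD normZ norm0_eq0.

Lemma rnorm_ell1E (a : ell1) : rnorm a = ell1_norm a.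
Proof. exact: scalar_of_realK. Qed.

End Ell1.

Section Completeness.
Context {R : realType} {k : scalar_kind}.
Local Notation K := (scalars R k).

Lemma rnormN (E : normedModType K) (x : E) : rnorm (- x) = rnorm x.
Proof. by rewrite /rnorm normrN. Qed.

Lemma rnorm_cauchyP (E : normedModType K) (G : set_system E) :
  ProperFilter G -> cauchy G ->
  forall e : R, 0 < e -> exists x, G [set y | rnorm (x - y) <= e].
Proof.
move=> GG /cauchyP Gc e e0.
have e'0 : 0 < @scalar_of_real R k e.
  by rewrite -(@scalar_of_real0 R k) ltr_scalar_of_real.
have [x Gx] := Gc _ e'0; exists x; apply: filterS Gx => y.
by rewrite -ball_normE /= -rnormE ltr_scalar_of_real => /ltW.
Qed.

Lemma rnorm_cvgP (E : normedModType K) (G : set_system E) (l : E) :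
  Filter G ->
  G --> l <-> forall e : R, 0 < e -> G [set y | rnorm (l - y) <= e].
Proof.
move=> GG; split=> [/cvgrPdist_le Gl e e0|Gl].
  have e'0 : 0 < @scalar_of_real R k e.
    by rewrite -(@scalar_of_real0 R k) ltr_scalar_of_real.
  apply: filterS (Gl _ e'0) => y.
  by rewrite -rnormE ler_scalar_of_real.
apply/cvgrPdist_le => e e0.
have re0 : 0 < scalar_re e.
  by rewrite -(@ltr_scalar_of_real R k) scalar_of_real0 scalar_reK// ltW.
apply: filterS (Gl _ re0) => y /=.
by rewrite -rnormE -{2}(scalar_reK (ltW e0)) ler_scalar_of_real.
Qed.

Definition cauchy_complete (T : puniformType) :=
  forall G : set_system T, ProperFilter G -> cauchy G -> cvg G.

Lemma scalars_complete : cauchy_complete K.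
Proof.
rewrite /scalars; case: k => G GG; first exact: (@cauchy_cvg R).
move=> /cauchyP Gc.
pose c : R -> R[i]%C := real_complex R.
have normE (z : R[i]%C) : `|z| = c (Num.sqrt (complex.Re z ^+ 2 + complex.Im z ^+ 2)).
  exact: normc_def.
have ReG (z : R[i]%C) : c `|complex.Re z| <= `|z|.
  by rewrite normE lecR -sqrtr_sqr ler_wsqrtr// lerDl sqr_ge0.
have ImG (z : R[i]%C) : c `|complex.Im z| <= `|z|.
  by rewrite normE lecR -sqrtr_sqr ler_wsqrtr// lerDr sqr_ge0.
have normG (z : R[i]%C) : `|z| <= c (`|complex.Re z| + `|complex.Im z|).
  rewrite normE lecR -[leRHS]ger0_norm ?addr_ge0// -sqrtr_sqr ler_wsqrtr//.
  rewrite sqrrD !real_normK ?num_real// lerD2r lerDl.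
  by rewrite mulrn_wge0// mulr_ge0.
have cvgG (p : R[i]%C -> R) : (forall z w, p (z - w) = p z - p w) ->
    (forall z, c `|p z| <= `|z|) -> cvg (p @ G).
  move=> pB pz; apply: cauchy_cvg; apply: cauchy_exP => e e0.
  have [|z Gz] := Gc (c e); first by rewrite ltcR.
  exists (p z); suff : G [set w | ball (p z) e (p w)] by [].
  apply: filterS Gz => w; rewrite -!ball_normE /= => zw.
  by rewrite -pB -ltcR (le_lt_trans (pz _)).
have ReB (z w : R[i]%C) :
    complex.Re (z - w) = complex.Re z - complex.Re w by case: z w => ? ? [].
have ImB (z w : R[i]%C) :
    complex.Im (z - w) = complex.Im z - complex.Im w by case: z w => ? ? [].
have /cvgrPdist_lt reG := cvgG _ ReB ReG.
have /cvgrPdist_lt imG := cvgG _ ImB ImG.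
apply/cvg_ex; exists (Complex (lim (@complex.Re R @ G)) (lim (@complex.Im R @ G))).
apply/cvgrPdist_lt => e e0.
have re0 : 0 < complex.Re e.
  by move: e0; rewrite ltcE => /andP[].
have eE : e = c (complex.Re e).
  by apply/esym/RRe_real; rewrite gtr0_real.
have r20 : 0 < complex.Re e / 2 by rewrite divr_gt0.
apply: filterS2 (reG _ r20) (imG _ r20) => w /= rw iw.
rewrite (le_lt_trans (normG _))// eE ltcR ReB ImB /= [ltRHS]splitr.
by rewrite ltrD.
Qed.

Lemma operator_complete (E F : normedModType K) :
  cauchy_complete F -> cauchy_complete (operator E F).
Proof.
move=> Fc G GG Gc.
have Gx x : cvg ((fun f : operator E F => f x) @ G).
  apply: Fc; apply: cauchy_exP => e e0.
  have re0 : 0 < scalar_re e.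
    by rewrite -(@ltr_scalar_of_real R k) scalar_of_real0 scalar_reK// ltW.
  have x0 : 0 < rnorm x + 1 by rewrite ltr_wpDl ?rnorm_ge0.
  have [f Gf] := rnorm_cauchyP GG Gc (divr_gt0 re0 x0).
  exists (f x); suff: G [set g : operator E F | ball (f x) e (g x)] by [].
  apply: filterS Gf => g /= fg.
  rewrite -ball_normE /= -rnormE -(scalar_reK (ltW e0)) ltr_scalar_of_real.
  rewrite -[f x - g x]/((f - g) x) (le_lt_trans (ler_operator_norm _ _))//.
  rewrite rnorm_operatorE in fg.
  rewrite (le_lt_trans (ler_wpM2r (rnorm_ge0 _) fg))//.
  by rewrite -mulrA gtr_pMr// mulrC ltr_pdivrMr// mul1r ltrDl.
pose l x : F := lim ((fun f : operator E F => f x) @ G).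
have lG x : (fun f : operator E F => f x) @ G --> l x by exact: Gx.
have close e f : 0 < e -> G [set g | rnorm (f - g) <= e] ->
    forall x, rnorm (f x - l x) <= e * rnorm x.
  move=> e0 Gf x; apply/ler_addgt0Pr => d d0.
  have /rnorm_cvgP/(_ _ d0) Gd := lG x.
  have Gd' : G [set g : operator E F | rnorm (l x - g x) <= d] by exact: Gd.
  have [g [/= fg gd]] := filter_ex (filterI Gf Gd').
  rewrite -(subrKA (g x)) (le_trans (ler_rnormD _ _))//.
  rewrite lerD//; last by rewrite -opprB rnormN.
  rewrite -[f x - g x]/((f - g) x) (le_trans (ler_operator_norm _ _))//.
  by rewrite ler_wpM2r ?rnorm_ge0// -rnorm_operatorE.
have lbl : l \in bounded_linear E F.
  apply/asboolP; split.
    move=> a x y; apply/cvg_lim => //=.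
    rewrite (_ : (fun f : operator E F => _) =
      (fun f : operator E F => a *: f x + f y)); last first.
      by apply/funext => f; rewrite linearP.
    exact: cvgD (cvgZ (cvg_cst a) (lG x)) (lG y).
  have [f Gf] := rnorm_cauchyP GG Gc ltr01.
  have [M fM] := operator_bounded f; exists (M + 1) => x.
  rewrite -[l x](subKr (f x)) (le_trans (ler_rnormD _ _))//.
  by rewrite mulrDl lerD// rnormN close.
apply/cvg_ex; exists (Operator lbl); apply/rnorm_cvgP => e e0.
have [f Gf] := rnorm_cauchyP GG Gc (divr_gt0 e0 (ltr0n _ 2)).
apply: filterS (Gf) => g /= fg.
rewrite -(subrKA f) (le_trans (ler_rnormD _ _))// [leRHS](splitr e) lerD//.
rewrite rnorm_operatorE; apply: operator_norm_le; first by rewrite ltW// divr_gt0.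
move=> x; rewrite -[_ x]/(l x - f x) -opprB rnormN close// divr_gt0//.
Qed.


Lemma injective_tensor_product_complete (E F : normedModType K) :
  cauchy_complete (injective_tensor_product E F).
Proof.
move=> G GG Gc.
pose H := (bilinear_form_of : injective_tensor_product E F -> _) @ G.
have Hc : cvg H.
  apply: (operator_complete (operator_complete scalars_complete)).
  apply: cauchy_exP => e e0.
  have re0 : 0 < scalar_re e.
    by rewrite -(@ltr_scalar_of_real R k) scalar_of_real0 scalar_reK// ltW.
  have [u Gu] := rnorm_cauchyP GG Gc (divr_gt0 re0 (ltr0n _ 2)).
  exists (bilinear_form_of u).
  suff : G [set v | ball (bilinear_form_of u) e (bilinear_form_of v)] by [].
  apply: filterS Gu => v /= uv.
  rewrite -ball_normE /= -rnormE -(scalar_reK (ltW e0)) ltr_scalar_of_real.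
  by rewrite (le_lt_trans uv)// ltr_pdivrMr// ltr_pMr// ltr1n.
have ul : lim H \in injective_tensor E F.
  apply/injective_tensor_approx => e e0.
  have e20 : 0 < e / 2 by rewrite divr_gt0.
  have /rnorm_cvgP/(_ _ e20) He := Hc.
  have [v /= Hv] := filter_ex (He : G [set v | rnorm (lim H - _) <= _]).
  have /injective_tensor_approx/(_ _ e20)[s vs] := injective_tensorP v.
  exists s; rewrite -(subrKA (bilinear_form_of v)).
  by rewrite (le_lt_trans (ler_rnormD _ _))// [ltRHS]splitr ler_ltD.
apply/cvg_ex; exists (InjectiveTensor ul); apply/rnorm_cvgP => e e0.
by have /rnorm_cvgP/(_ _ e0) := Hc.
Qed.

End Completeness.

Section Properties.
Context {R : realType} {k : scalar_kind}.
Local Notation K := (scalars R k).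
Implicit Types E F : normedModType K.

Definition weakly_converges E (x : nat -> E) (l : E) :=
  forall phi : dual E, (fun n => phi (x n)) @ \oo --> phi l.

Definition weakly_cauchy E (x : nat -> E) :=
  forall phi : dual E, cauchy ((fun n => phi (x n)) @ \oo).

Definition weak_topology E :=
  initial_topology (fun x : E => (fun phi => phi x) : {ptws dual E -> K}).

Definition weakly_compact_operator E F (T : operator E F) :=
  precompact (T @` [set x | `|x| <= 1] : set (weak_topology F)).

Definition completely_continuous E F (T : operator E F) :=
  forall x : nat -> E, weakly_cauchy x -> cauchy ((fun n => T (x n)) @ \oo).

Definition dunford_pettis E :=
  forall (F : completeNormedModType K) (T : operator E F),
    weakly_compact_operator T -> completely_continuous T.

Definition schur_property E :=
  forall (x : nat -> E) (l : E), weakly_converges x l -> cvgn x.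

(* The image of [T], a closed subspace of [E], is linearly homeomorphic to
   l_1 through [T], whose inverse on its image is [S]. *)
Definition contains_copy_of_ell1 E :=
  exists (T : operator (ell1 R k) E) (S : E -> ell1 R k),
    [/\ closed (range T), cancel T S & {within range T, continuous S}].

End Properties.

(* Main.v *)
From HB Require Import structures.
Require Import Defs.
From mathcomp Require Import all_boot all_order all_algebra.
From mathcomp Require Import complex ring lra.
From mathcomp Require Import all_classical all_reals all_analysis.

(** Write X for the injective tensor product of E and F.  The Dunford-Pettis
    property of X^* is refuted by a weakly null sequence u_n in X^* and a weakly
    compact operator S on X^* for which S u_n does not tend to 0.

    The sequence.  As E^* is not Schur, it contains a weakly null sequence phi_n
    whose norms do not tend to 0; let psi_n be the image in F^* of the n-th unit
    vector of l_1.  Put u_n = phi_n (x) psi_n, that is, u_n(x (x) y) =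
    phi_n(x) psi_n(y).  A functional Xi on X^* induces the operator
    T : E^* -> F^** with T(phi)(psi) = Xi(phi (x) psi).  By hypothesis T is
    completely continuous, so T(phi_n) tends to 0 in norm, hence so does
    Xi(u_n) = T(phi_n)(psi_n): the u_n are weakly null
    ([rank_one_weakly_null]).

    The operator.  Choose x_n in the unit ball of E that almost norm phi_n.
    Slicing u in X^* at x gives the element u(x (x) -) of F^*, and S u is the
    scalar sequence eta_n(u(x_n (x) -)) for functionals eta_n on F^* such that
    eta_n(psi_n) = 1 and the norm of sum a_n eta_n is at most a multiple of the
    l_2 norm of a.  Then (S u_n)_n = phi_n(x_n), which does not tend to 0,
    although each coordinate of S u_n does.

    The eta_n come from a single application of the Hahn-Banach theorem
    ([rademacher_coordinates]), on the space of sequences f in F^* whose sign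
    averages E|sum_i +-f_i| are bounded, with their supremum as a seminorm.  On
    sequences (a_n psi_n)_n every choice of signs gives a norm at least
    d sum |a_n|, so (a_n psi_n)_n |-> sum a_n is dominated by the seminorm.

    The l_2 bound for S comes from the fact that the slicing map
    x |-> u(x (x) -) is absolutely summing ([slice_absolutely_summing]):
    this bounds E|sum_i +-a_i u(x_i (x) -)| by the norm of u times the
    supremum over phi in the unit ball of E|sum_i +-a_i phi(x_i)|, and second
    moments of sign averages are computed by the parallelogram law
    ([sign_second_moment]).

    The values of S are taken in the dual of the space of finitely supported
    sequences with the l_1 norm.  That dual, l_oo, is complete, and an l_2 ball
    in it is weakly compact ([square_summable_ball_weakly_compact]): a bounded
    functional on l_oo is absolutely summable along the coordinate functionals,
    and so on sequences tending to 0 with a common bound it is a uniform limit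
    of finite combinations of coordinates. *)

Set Implicit Arguments.
Unset Strict Implicit.
Unset Printing Implicit Defensive.

Import Order.TTheory GRing.Theory Num.Theory.
Import numFieldNormedType.Exports.

Local Open Scope classical_set_scope.
Local Open Scope ring_scope.

(** * Minimal sublinear functionals *)

Section HahnBanach.
Context {R : realType} {k : scalar_kind}.
Local Notation K := (scalars R k).
Local Notation inj := (@scalar_of_real R k).
Variable V : lmodType K.
Implicit Types (p q : V -> R) (P : set (V * R)).

Definition sublinear q :=
  (forall x y, q (x + y) <= q x + q y) /\
  (forall t x, 0 <= t -> q (inj t *: x) <= t * q x).

Definition convex_cone P :=
  [/\ P (0, 0), (forall c d, P c -> P d -> P (c.1 + d.1, c.2 + d.2)) &
      (forall t c, 0 <= t -> P c -> P (inj t *: c.1, t * c.2))].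

Lemma sublinear0 q : sublinear q -> q 0 = 0.
Proof.
move=> [qD qZ]; apply/eqP; rewrite eq_le; apply/andP; split.
  by have := qZ 0 0 (lexx 0); rewrite scaler0 mul0r.
by have := qD 0 0; rewrite addr0 -subr_ge0 addrK.
Qed.

Lemma sublinear_opp_le q x : sublinear q -> - q (- x) <= q x.
Proof.
move=> sq; have := sq.1 x (- x).
by rewrite subrr (sublinear0 sq) addrC -lerBlDl sub0r.
Qed.

(** The largest sublinear functional below [q] that is at most [c.2] at [c.1] for
    every [c] in the convex cone [P]. *)
Definition cone_minorant q P x : R := inf [set q (x - c.1) + c.2 | c in P].

Section ConeMinorant.
Variables (q : V -> R) (P : set (V * R)).
Hypotheses (sq : sublinear q) (cP : convex_cone P).
Hypothesis qP : forall c, P c -> 0 <= q (- c.1) + c.2.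

Lemma cone_minorant_has_inf x : has_inf [set q (x - c.1) + c.2 | c in P].
Proof.
have [P0 _ _] := cP; split; first by eexists; exists (0, 0).
exists (- q (- x)) => _ [c Pc <-].
have := sq.1 (x - c.1) (- x); rewrite addrAC subrr add0r => h.
by have := qP Pc; lra.
Qed.

Lemma cone_minorant_le x c : P c -> cone_minorant q P x <= q (x - c.1) + c.2.
Proof.
by move=> Pc; apply: ge_inf; [have [] := cone_minorant_has_inf x|exists c].
Qed.

Lemma sublinear_cone_minorant : sublinear (cone_minorant q P).
Proof.
have [P0 PD PZ] := cP; split=> [x y|t x t0].
  rewrite -lerBlDr; apply: lb_le_inf => [|_ [c Pc <-]].
    by have [] := cone_minorant_has_inf x.
  rewrite lerBlDr -lerBlDl; apply: lb_le_inf => [|_ [d Pd <-]].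
    by have [] := cone_minorant_has_inf y.
  rewrite lerBlDl (le_trans (cone_minorant_le _ (PD _ _ Pc Pd)))//=.
  rewrite opprD addrACA; have := sq.1 (x - c.1) (y - d.1); lra.
move: t0; rewrite le_eqVlt => /predU1P[<-|t0].
  rewrite scalar_of_real0 scale0r mul0r.
  have := cone_minorant_le 0 P0; rewrite /= subr0 addr0.
  by rewrite (sublinear0 sq).
rewrite -ler_pdivrMl//; apply: lb_le_inf => [|_ [c Pc <-]].
  by have [] := cone_minorant_has_inf x.
rewrite ler_pdivrMl// (le_trans (cone_minorant_le _ (PZ _ _ (ltW t0) Pc)))//=.
by rewrite mulrDr lerD2r -scalerBr sq.2// ltW.
Qed.

End ConeMinorant.

(** Zorn's lemma: the infimum of a chain of sublinear functionals is finite at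
    [x], because each member is at least [- p (- x)] there. *)
Lemma minimal_sublinear p : sublinear p -> exists q, [/\ sublinear q,
  (forall x, q x <= p x) &
  forall q', sublinear q' -> (forall x, q' x <= q x) -> forall x, q' x = q x].
Proof.
move=> sp.
pose T := {q : V -> R | sublinear q /\ forall x, q x <= p x}.
pose below (a b : T) := `[< forall x, sval b x <= sval a x >].
have [||||[q [sq qp]] qmin] := @Zorn T below.
- by move=> a; apply/asboolP.
- move=> b a c /asboolP ba /asboolP ac; apply/asboolP => x.
  exact: le_trans (ac x) (ba x).
- move=> [a pa] [b pb] /asboolP ab /asboolP ba; apply: eq_exist.
  by apply/funext => x; apply/eqP; rewrite eq_le (ab x) (ba x).
- move=> A Atot; have [[a0 Aa0]|A0] := pselect (A !=set0); last first.
    by exists (exist _ p (conj sp (fun x => lexx _))) => s As; case: A0; exists s.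
  pose m x := inf [set sval a x | a in A].
  have has_m x : has_inf [set sval a x | a in A].
    split; first by exists (sval a0 x), a0.
    exists (- p (- x)) => _ [[a [sa ap]] Aa <-] /=.
    by apply: le_trans (sublinear_opp_le x sa); rewrite lerN2.
  have m_le a x : A a -> m x <= sval a x.
    by move=> Aa; apply: ge_inf; [have [] := has_m x|exists a].
  have m_ge b x : (forall a, A a -> b <= sval a x) -> b <= m x.
    move=> bA; apply: lb_le_inf; first by have [] := has_m x.
    by move=> _ [a Aa <-]; exact: bA.
  have sm : sublinear m.
    split=> [x y|t x].
      rewrite -lerBlDr; apply: (m_ge _ _) => a Aa.
      rewrite lerBlDr -lerBlDl; apply: (m_ge _ _) => b Ab; rewrite lerBlDl.
      have [/asboolP ab|/asboolP ba] := Atot _ _ Aa Ab.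
        apply: le_trans (m_le _ _ Ab) _.
        by apply: le_trans ((svalP b).1.1 x y) _; rewrite lerD2r; exact: ab.
      apply: le_trans (m_le _ _ Aa) _.
      by apply: le_trans ((svalP a).1.1 x y) _; rewrite lerD2l; exact: ba.
    rewrite le_eqVlt => /predU1P[<-|t0].
      rewrite mul0r (le_trans (m_le a0 _ Aa0))//.
      by rewrite (le_trans ((svalP a0).1.2 _ _ (lexx 0)))// mul0r.
    rewrite -ler_pdivrMl//; apply: (m_ge _ _) => a Aa; rewrite ler_pdivrMl//.
    by rewrite (le_trans (m_le _ _ Aa))//; exact: ((svalP a).1.2 _ _ (ltW t0)).
  have mp x : m x <= p x.
    exact: le_trans (m_le _ _ Aa0) ((svalP a0).2 x).
  exists (exist _ m (conj sm mp)) => a Aa; apply/asboolP => x; exact: m_le.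
- exists q; split=> // q' sq' q'q x.
  have q'p y : q' y <= p y by exact: le_trans (q'q y) (qp y).
  have := qmin (exist _ q' (conj sq' q'p)) (asboolT q'q).
  by move=> /(congr1 (fun a : T => sval a x)).
Qed.

(** Lowering [q] along the ray of [- y] to the value [- q y] yields a sublinear
    functional, which minimality forces to be [q] itself; comparing values at
    [x] gives superadditivity. *)
Lemma minimal_sublinear_additive q : sublinear q ->
  (forall q', sublinear q' -> (forall x, q' x <= q x) -> forall x, q' x = q x) ->
  {morph q : x y / x + y}.
Proof.
move=> sq qmin x y; apply/eqP; rewrite eq_le sq.1/=.
pose P : set (V * R) := [set c | exists2 t, 0 <= t & c = (- (inj t *: y), - (t * q y))].
have cP : convex_cone P.
  split; first by exists 0; rewrite // scalar_of_real0 scale0r mul0r !oppr0.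
    move=> _ _ [t t0 ->] [s s0 ->]; exists (t + s); rewrite ?addr_ge0//=.
    by rewrite scalar_of_realD scalerDl !opprD mulrDl opprD.
  move=> t _ t0 [s s0 ->]; exists (t * s); rewrite ?mulr_ge0//=.
  by rewrite scalar_of_realM !scalerN scalerA mulrN mulrA.
have Pt t : 0 < t -> q (inj t *: y) = t * q y.
  move=> t0; apply/eqP; rewrite eq_le (sq.2 _ _ (ltW t0))/= -ler_pdivlMl//.
  have ti : 0 <= t^-1 by rewrite invr_ge0 ltW.
  apply: le_trans (sq.2 _ (inj t *: y) ti); rewrite scalerA -scalar_of_realM.
  by rewrite mulVf ?gt_eqF// scalar_of_real1 scale1r.
have qP c : P c -> 0 <= q (- c.1) + c.2.
  move=> [t t0 ->] /=; rewrite opprK subr_ge0.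
  move: t0; rewrite le_eqVlt => /predU1P[<-|/Pt ->//].
  by rewrite scalar_of_real0 scale0r mul0r (sublinear0 sq).
have minor z : cone_minorant q P z <= q z.
  have [P0 _ _] := cP.
  by have := cone_minorant_le sq cP qP z P0; rewrite /= subr0 addr0.
have E := qmin _ (sublinear_cone_minorant sq cP qP) minor x.
have Py : P (- y, - q y).
  by exists 1; rewrite ?ler01// scalar_of_real1 scale1r mul1r.
by have := cone_minorant_le sq cP qP x Py; rewrite E/= opprK -lerBlDr opprK.
Qed.

End HahnBanach.

(** * The Hahn-Banach theorem over real or complex scalars *)

Section Scalars.
Context {R : realType} {k : scalar_kind}.
Local Notation K := (scalars R k).
Local Notation inj := (@scalar_of_real R k).
Implicit Types x y z : K.

Lemma scalar_reD x y : scalar_re (x + y) = scalar_re x + scalar_re y.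
Proof. by move: x y; rewrite /scalar_re; case: k => // -[? ?] [? ?]. Qed.

Lemma scalar_reMl (t : R) z : scalar_re (inj t * z) = t * scalar_re z.
Proof.
move: z; rewrite /scalar_re /scalar_of_real; case: k => // -[a b] /=.
by rewrite mul0r subr0.
Qed.

Lemma scalar_reN z : scalar_re (- z) = - scalar_re z.
Proof. by move: z; rewrite /scalar_re; case: k => // -[]. Qed.

Lemma scalar_rotation z : exists2 a : K, rnorm a <= 1 & a * z = inj (rnorm z).
Proof.
have [->|z0] := eqVneq z 0.
  by exists 0; rewrite ?rnorm0 ?ler01// mul0r scalar_of_real0.
exists (`|z| / z); last by rewrite divfK// rnormE.
rewrite -(@ler_scalar_of_real R k) rnormE normrM normfV normr_id.
by rewrite divff ?normr_eq0// scalar_of_real1.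
Qed.

Lemma scalar_re_le_rnorm z : scalar_re z <= rnorm z.
Proof.
rewrite /rnorm; move: z; rewrite /scalar_re; case: k => [z|z]; first exact: ler_norm.
rewrite (le_trans (ler_norm _))// -lecR [leRHS](_ : _ = `|z|).
  by rewrite normc_ge_Re.
by rewrite (RRe_real (ger0_real (normr_ge0 z))).
Qed.

Lemma parallelogram x y :
  rnorm (x + y) ^+ 2 + rnorm (x - y) ^+ 2 = 2 * (rnorm x ^+ 2 + rnorm y ^+ 2).
Proof.
rewrite /rnorm; move: x y; rewrite /scalar_re /scalars; case: k => [x y|x y].
  by rewrite !real_normK ?num_real//; ring.
have sq (z : R[i]%C) : complex.Re `|z| ^+ 2 = complex.Re z ^+ 2 + complex.Im z ^+ 2.
  by rewrite normc_def /= sqr_sqrtr// addr_ge0 ?sqr_ge0.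
by rewrite !sq; case: x y => [a b] [c d] /=; ring.
Qed.

(** In the complex case [L v] is [q v - i q (i v)]. *)
Lemma real_part_extension (V : lmodType K) (q : V -> R) :
  {morph q : u v / u + v} -> (forall t v, q (inj t *: v) = t * q v) ->
  exists2 L : V -> K, scalar L & forall v, scalar_re (L v) = q v.
Proof.
move: V q; rewrite /scalars /scalar_of_real /scalar_re; case: k => V q qD qZ.
  by exists q => // a u v; rewrite qD qZ.
have qN v : q (- v) = - q v.
  by rewrite -scaleN1r (_ : -1 = real_complex R (-1)) ?qZ ?mulN1r// rmorphN.
exists (fun v => Complex (q v) (- q (Complex 0 1 *: v))) => // -[a b] u v.
have E : Complex a b = real_complex R a + real_complex R b * Complex 0 1.
  by apply/eqP; rewrite eq_complex /=; apply/andP; split; apply/eqP; ring.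
have i2 : Complex 0 1 * Complex 0 1 = -1 :> R[i]%C.
  by apply/eqP; rewrite eq_complex /=; apply/andP; split; apply/eqP; ring.
have q1 : q (Complex a b *: u) = a * q u + b * q (Complex 0 1 *: u).
  by rewrite E scalerDl qD -scalerA !qZ.
have q2 : q (Complex 0 1 *: (Complex a b *: u)) = a * q (Complex 0 1 *: u) - b * q u.
  rewrite scalerA E mulrDr scalerDl qD mulrCA i2 [_ * real_complex R a]mulrC.
  by rewrite -!scalerA !qZ scaleN1r qN mulrN.
rewrite scalerDr !qD q1 q2.
by apply/eqP; rewrite eq_complex /=; apply/andP; split; apply/eqP; ring.
Qed.

End Scalars.

Section HahnBanachTheorem.
Context {R : realType} {k : scalar_kind}.
Local Notation K := (scalars R k).
Local Notation inj := (@scalar_of_real R k).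
Variables V W : lmodType K.

(** A minimal sublinear functional below the one that [p] and the cone of the pairs
    [(j w, Re (l w))] determine is real-linear and agrees with [Re l] on the
    image of [j]; it is the real part of the extension. *)
Theorem hahn_banach (p : V -> R) (j : {linear W -> V}) (l : {scalar W}) :
  (forall x y, p (x + y) <= p x + p y) ->
  (forall a x, p (a *: x) <= rnorm (a : K) * p x) ->
  (forall w, rnorm (l w : K) <= p (j w)) ->
  exists2 L : {scalar V},
    forall v, rnorm (L v : K) <= p v & forall w, L (j w) = l w.
Proof.
move=> pD pZ lp.
have sp : sublinear p.
  by split=> // t x t0; rewrite (le_trans (pZ _ _))// rnorm_of_real.
have p_ge0 v : 0 <= p v.
  have r1 : rnorm (-1 : K) = 1.
    by rewrite rnormN -(@scalar_of_real1 R k) rnorm_of_real.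
  have := pD v (-1 *: v); have := pZ (-1) v; rewrite r1 scaleN1r subrr.
  have := pD 0 0; rewrite addr0; lra.
pose P : set (V * R) := [set c | exists w, c = (j w, scalar_re (l w))].
have cP : convex_cone P.
  split=> [|_ _ [w ->] [w' ->]|t _ t0 [w ->]].
  - exists 0; rewrite !linear0.
    by have := scalar_reMl 0 (0 : K); rewrite mulr0 mul0r => ->.
  - by exists (w + w'); rewrite !linearD/= scalar_reD.
  - by exists (inj t *: w); rewrite !linearZ/= scalar_reMl.
have qP c : P c -> 0 <= p (- c.1) + c.2.
  move=> [w ->] /=; rewrite -linearN -lerBlDr sub0r -scalar_reN -linearN.
  exact: le_trans (scalar_re_le_rnorm _) (lp _).
have [q [sq qle qmin]] := minimal_sublinear (sublinear_cone_minorant sp cP qP).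
have qD := minimal_sublinear_additive sq qmin.
have q0 := sublinear0 sq.
have qN v : q (- v) = - q v.
  by apply/eqP; rewrite -subr_eq0 opprK -qD addNr q0.
have qZ t x : q (inj t *: x) = t * q x.
  have pos s y : 0 <= s -> q (inj s *: y) = s * q y.
    move=> s0; apply/eqP; rewrite eq_le (sq.2 _ _ s0)/=.
    by have := sq.2 _ (- y) s0; rewrite scalerN !qN mulrN lerN2.
  have [t0|t0] := leP 0 t; first exact: pos.
  have injN : inj t = - inj (- t).
    by apply/eqP; rewrite -subr_eq0 opprK -scalar_of_realD subrr scalar_of_real0.
  by rewrite injN scaleNr qN pos ?oppr_ge0 1?ltW// mulNr opprK.
have [L Ls Lq] := real_part_extension qD qZ.
pose LL : {scalar V} := HB.pack L (GRing.isLinear.Build K V K *%R L Ls).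
have qp v : q v <= p v.
  apply: le_trans (qle v) _; have [P0 _ _] := cP.
  by have := cone_minorant_le sp cP qP v P0; rewrite /= subr0 addr0.
exists LL => [v|w].
  have [a a1 aL] := scalar_rotation (L v).
  have -> : rnorm (LL v : K) = q (a *: v).
    by rewrite -Lq -[L _]/(LL _) linearZ/= [a * _]aL scalar_of_realK.
  by rewrite (le_trans (qp _))// (le_trans (pZ _ _))// ler_piMl// p_ge0.
have qj v : q (j v) <= scalar_re (l v).
  apply: le_trans (qle (j v)) _.
  have Pv : P (j v, scalar_re (l v)) by exists v.
  have := cone_minorant_le sp cP qP (j v) Pv.
  by rewrite /= subrr (sublinear0 sp) add0r.
have qjE v : q (j v) = scalar_re (l v).
  apply/eqP; rewrite eq_le qj/= -lerN2 -qN -scalar_reN -!linearN; exact: qj.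
apply/eqP; rewrite -subr_eq0; apply/eqP/(@rnorm0_eq0 R k K).
have [a _ aL] := scalar_rotation (LL (j w) - l w : K).
rewrite -[LHS](@scalar_of_realK R k) -aL mulrBr scalar_reD scalar_reN.
have -> : a * LL (j w) = LL (j (a *: w)) by rewrite !linearZ.
have -> : a * l w = l (a *: w) by rewrite linearZ.
by rewrite Lq qjE subrr.
Qed.

End HahnBanachTheorem.

(** * Averages over signs *)

Section SignMeans.
Context {R : realType} {k : scalar_kind}.
Local Notation K := (scalars R k).

Fixpoint sign_patterns N : seq (seq bool) :=
  if N is n.+1 then
    [seq true :: s | s <- sign_patterns n] ++
    [seq false :: s | s <- sign_patterns n]
  else [:: [::]].

(** The pattern [s] encodes the signs [(-1) ^+ s_i]; a mean is taken over the
    [2 ^ N] patterns of length [N]. *)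
Definition sign_mean N (g : seq bool -> R) : R :=
  2 ^- N * \sum_(s <- sign_patterns N) g s.

Definition signed_sum (V : lmodType K) (f : nat -> V) N (s : seq bool) : V :=
  \sum_(i < N) (-1) ^+ nth false s i *: f i.

Lemma sign_meanS N g : sign_mean N.+1 g =
  (sign_mean N (fun s => g (true :: s)) + sign_mean N (fun s => g (false :: s))) / 2.
Proof.
by rewrite /sign_mean /= big_cat !big_map exprS invfM -mulrDr mulrC mulrA mulrC mulrA.
Qed.

Lemma sign_mean_cst N (c : R) : sign_mean N (fun=> c) = c.
Proof.
elim: N => [|N IH]; last by rewrite sign_meanS IH mulrDl -splitr.
by rewrite /sign_mean /= big_seq1 invr1 mul1r.
Qed.

Lemma ler_sign_mean N g h : (forall s, g s <= h s) ->
  sign_mean N g <= sign_mean N h.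
Proof.
by move=> gh; rewrite ler_wpM2l ?invr_ge0 ?exprn_ge0// ler_sum.
Qed.

Lemma sign_meanD N g h :
  sign_mean N (fun s => g s + h s) = sign_mean N g + sign_mean N h.
Proof. by rewrite /sign_mean big_split mulrDr. Qed.

Lemma sign_meanZ N c g : sign_mean N (fun s => c * g s) = c * sign_mean N g.
Proof. by rewrite /sign_mean -big_distrr mulrCA. Qed.

Lemma signed_sumS (V : lmodType K) (f : nat -> V) N b s :
  signed_sum f N.+1 (b :: s) = (-1) ^+ b *: f 0%N + signed_sum (f \o succn) N s.
Proof. by rewrite /signed_sum big_ord_recl. Qed.

(** The offset [w] makes the induction on [N] work: averaging over the first sign
    is the parallelogram law. *)
Lemma sign_second_moment N (f : nat -> K) (w : K) :
  sign_mean N (fun s => rnorm (w + signed_sum f N s) ^+ 2) =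
  rnorm w ^+ 2 + \sum_(i < N) rnorm (f i) ^+ 2.
Proof.
elim: N f w => [|N IH] f w.
  by rewrite /sign_mean /= big_seq1 /signed_sum !big_ord0 !addr0 invr1 mul1r.
rewrite sign_meanS.
under eq_fun do rewrite signed_sumS addrA.
under [X in _ + sign_mean _ X]eq_fun do rewrite signed_sumS addrA.
rewrite !IH big_ord_recl /= expr1 expr0 scaleN1r scale1r.
set T := \sum_(i < N) _.
have := parallelogram w (f 0%N).
by move=> h; apply: (mulIf (_ : 2 != 0 :> R)); rewrite ?divfK ?pnatr_eq0//; lra.
Qed.

Lemma ler_rnorm_sum (V : normedModType K) (I : Type) (r : seq I) (P : pred I)
    (f : I -> V) : rnorm (\sum_(i <- r | P i) f i) <= \sum_(i <- r | P i) rnorm (f i).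
Proof.
elim/big_ind2: _ => [|x a y b xa yb|//]; first by rewrite rnorm0.
exact: le_trans (ler_rnormD _ _) (lerD xa yb).
Qed.

Lemma rnorm_sign (b : nat) (V : normedModType K) (x : V) :
  rnorm ((-1) ^+ b *: x) = rnorm x.
Proof. by rewrite -signr_odd; case: odd; rewrite ?scaleN1r ?scale1r ?rnormN. Qed.

Lemma rnorm_signed_sum_le (V : normedModType K) (f : nat -> V) N s :
  rnorm (signed_sum f N s) <= \sum_(i < N) rnorm (f i).
Proof.
by rewrite (le_trans (ler_rnorm_sum _ _ _))// ler_sum// => i _; rewrite rnorm_sign.
Qed.

Lemma ler_sum_support (a : nat -> R) n N : (forall i, 0 <= a i) ->
  (forall i, (n <= i)%N -> a i = 0) -> \sum_(i < N) a i <= \sum_(i < n) a i.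
Proof.
move=> a0 an; rewrite -!(big_mkord xpredT a).
have [nN|/ltnW Nn] := leqP n N; last first.
  by rewrite (@big_cat_nat _ _ _ N 0 n)//= lerDl sumr_ge0.
by rewrite (@big_cat_nat _ _ _ n 0 N)//= gerDl big_nat big1// => i /andP[/an].
Qed.

End SignMeans.

(** * Sequences with bounded sign averages *)

Section RademacherSequences.
Context {R : realType} {k : scalar_kind}.
Local Notation K := (scalars R k).
Variable G : normedModType K.
Implicit Types f g : nat -> G.

Definition rademacher_mean f N : R :=
  sign_mean N (fun s => rnorm (signed_sum f N s)).

Definition rademacher_bounded : {pred nat -> G} := fun f =>
  `[< exists M, forall N, rademacher_mean f N <= M >].

Lemma rademacher_meanD f g N :
  rademacher_mean (f + g) N <= rademacher_mean f N + rademacher_mean g N.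
Proof.
rewrite -sign_meanD; apply: ler_sign_mean => s.
rewrite (le_trans _ (ler_rnormD _ _))// le_eqVlt; apply/orP; left; apply/eqP.
congr rnorm; rewrite /signed_sum -big_split; apply: eq_bigr => i _ /=.
by rewrite -scalerDr.
Qed.

Lemma rademacher_meanZ (a : K) f N :
  rademacher_mean (a *: f) N = rnorm a * rademacher_mean f N.
Proof.
rewrite -sign_meanZ; congr sign_mean; apply/funext => s; rewrite -rnormZ.
congr rnorm; rewrite /signed_sum scaler_sumr; apply: eq_bigr => i _.
by rewrite !scalerA mulrC.
Qed.

Lemma rademacher_mean_le f N : rademacher_mean f N <= \sum_(i < N) rnorm (f i).
Proof.
rewrite -[leRHS](sign_mean_cst N); apply: ler_sign_mean => s.
exact: rnorm_signed_sum_le.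
Qed.

Lemma rademacher_bounded_submod : submod_closed rademacher_bounded.
Proof.
split.
  apply/asboolP; exists 0 => N; rewrite (le_trans (rademacher_mean_le _ _))//.
  by rewrite big1// => i _; exact: rnorm0.
move=> a f g /asboolP[M fM] /asboolP[M' gM]; apply/asboolP.
exists (rnorm a * M + M') => N; rewrite (le_trans (rademacher_meanD _ _ _))//.
by rewrite rademacher_meanZ lerD// ler_wpM2l ?rnorm_ge0.
Qed.

(** Sequences of infinite support are allowed, so that the supremum of the sign
    averages is by definition finite. *)
Record rademacher_seq := RademacherSeq {
  rademacher_fun :> nat -> G;
  rademacher_seqP : rademacher_fun \in rademacher_bounded }.

HB.instance Definition _ := [isSub for rademacher_fun].
HB.instance Definition _ := [Choice of rademacher_seq by <:].
HB.instance Definition _ := GRing.isSubmodClosed.Build K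
  (nat -> G) rademacher_bounded rademacher_bounded_submod.
HB.instance Definition _ := [SubChoice_isSubLmodule of rademacher_seq by <:].

Implicit Types x y : rademacher_seq.

Definition rademacher_norm x : R := sup (range (rademacher_mean x)).

Lemma rademacher_mean_le_norm x N : rademacher_mean x N <= rademacher_norm x.
Proof.
apply: sup_upper_bound; last by exists N.
split; first by exists (rademacher_mean x 0), 0%N.
by have /asboolP[M xM] := rademacher_seqP x; exists M => _ [n _ <-].
Qed.

Lemma rademacher_norm_le x M :
  (forall N, rademacher_mean x N <= M) -> rademacher_norm x <= M.
Proof.
move=> xM; apply: ge_sup; first by exists (rademacher_mean x 0), 0%N.
by move=> _ [n _ <-].
Qed.

Lemma rademacher_normD x y :
  rademacher_norm (x + y) <= rademacher_norm x + rademacher_norm y.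
Proof.
apply: rademacher_norm_le => N; rewrite (le_trans (rademacher_meanD x y N))//.
by rewrite lerD// rademacher_mean_le_norm.
Qed.

Lemma rademacher_normZ (a : K) x :
  rademacher_norm (a *: x) <= rnorm a * rademacher_norm x.
Proof.
apply: rademacher_norm_le => N; rewrite [leLHS](rademacher_meanZ a x N).
by rewrite ler_wpM2l ?rnorm_ge0// rademacher_mean_le_norm.
Qed.

Lemma poly_scaled_rademacher (w : {poly K}) (g : nat -> G) :
  (fun n => w`_n *: g n) \in rademacher_bounded.
Proof.
apply/asboolP; exists (\sum_(i < size w) rnorm (w`_i *: g i)) => N.
apply: le_trans (rademacher_mean_le _ N) _.
apply: (@ler_sum_support _ (fun i => rnorm (w`_i *: g i))) => [i|i wi].
  exact: rnorm_ge0.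
by rewrite nth_default// scale0r rnorm0.
Qed.

(** Polynomials serve as finitely supported scalar sequences throughout: the
    coefficient of ['X^n] is the [n]-th entry. *)
Definition poly_scaled (g : nat -> G) (w : {poly K}) : rademacher_seq :=
  RademacherSeq (poly_scaled_rademacher w g).

Lemma poly_scaled_is_linear g : linear (poly_scaled g).
Proof.
move=> a v w; apply/val_inj/funext => n /=.
by rewrite coefD coefZ scalerDl -scalerA.
Qed.

HB.instance Definition _ g := GRing.isLinear.Build K {poly K} rademacher_seq
  *:%R (poly_scaled g) (poly_scaled_is_linear g).

(** On the sequences [(w_n g_n)_n] each choice of signs already gives a norm at
    least [d] times the l_1 norm of [w], so the sum of the entries of [w], which
    is [w.[1]], is dominated by the sign averages, and Hahn-Banach applies.  The
    functionals [eta_n] are the restrictions of [L] to the sequences supported at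
    [n]; the case [w = 'X^n] says that [eta_n] takes the value 1 at [g n]. *)
Lemma rademacher_coordinates (g : nat -> G) (d : R) : 0 < d ->
  (forall (a : nat -> K) N,
    d * \sum_(i < N) rnorm (a i) <= rnorm (\sum_(i < N) a i *: g i)) ->
  exists2 L : {scalar rademacher_seq},
    forall x, rnorm (L x : K) <= d^-1 * rademacher_norm x &
    forall w, L (poly_scaled g w) = w.[1].
Proof.
move=> d0 dg.
pose p x := d^-1 * rademacher_norm x.
pose h : {scalar {poly K}} := horner_eval (1 : K).
apply: (@hahn_banach R k rademacher_seq {poly K} p (poly_scaled g) h).
- by move=> x y; rewrite /p -mulrDr ler_wpM2l ?invr_ge0 ?(ltW d0)// rademacher_normD.
- move=> a x; rewrite /p mulrCA ler_wpM2l ?invr_ge0 ?(ltW d0)//.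
  exact: rademacher_normZ.
move=> w; rewrite /p ler_pdivlMl//.
apply: le_trans (rademacher_mean_le_norm _ (size w)).
rewrite -[leLHS](sign_mean_cst (size w)); apply: ler_sign_mean => s.
rewrite /signed_sum /=; under eq_bigr do rewrite scalerA.
apply: le_trans (dg (fun i => (-1) ^+ nth false s i * w`_i) (size w)).
rewrite ler_pM2l// /h /horner_eval horner_coef.
apply: le_trans (ler_rnorm_sum _ _ _) _; apply: ler_sum => i _.
by rewrite expr1n mulr1 -[leRHS]/(rnorm ((-1) ^+ _ *: (w`_i : K))) rnorm_sign.
Qed.

End RademacherSequences.

(** * Copies of l_1 *)

Section Ell1Copy.
Context {R : realType} {k : scalar_kind}.
Local Notation K := (scalars R k).
Local Notation inj := (@scalar_of_real R k).

Definition truncation (a : nat -> K) (N : nat) : nat -> K :=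
  fun n => if (n < N)%N then a n else 0.

Lemma truncation_series_cvg (a : nat -> K) N :
  series (fun n => rnorm (truncation a N n : K)) @ \oo --> \sum_(i < N) rnorm (a i : K).
Proof.
apply: cvg_near_cst; near=> n.
have Nn : (N <= n)%N by near: n; exact: nbhs_infty_ge.
rewrite seriesEnat /= (@big_cat_nat _ _ _ N)//= [X in _ + X]big_nat.
rewrite [X in _ + X]big1 ?addr0 => [|i /andP[Ni _]]; last first.
  by rewrite /truncation ltnNge Ni rnorm0.
by rewrite big_mkord; apply: eq_bigr => i _; rewrite /truncation ltn_ord.
Unshelve. all: by end_near. Qed.

Lemma truncation_summable (a : nat -> K) N : truncation a N \in @summable_seq R k.
Proof. by apply/asboolP; apply: cvgP (@truncation_series_cvg a N). Qed.

Definition ell1_truncation a N : ell1 R k := Ell1 (truncation_summable a N).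

Lemma rnorm_ell1_truncation a N :
  rnorm (ell1_truncation a N) = \sum_(i < N) rnorm (a i : K).
Proof. rewrite rnorm_ell1E; apply: cvg_lim => //; exact: truncation_series_cvg. Qed.

Definition ell1_basis n : ell1 R k := ell1_truncation (fun i => (i == n)%:R) n.+1.

Lemma ell1_truncationE a N :
  ell1_truncation a N = \sum_(i < N) a i *: ell1_basis i.
Proof.
elim: N => [|N IH]; first by rewrite big_ord0; apply/val_inj/funext.
rewrite big_ord_recr /= -IH; apply/val_inj/funext => n /=.
rewrite -[RHS]/(truncation a N n + a N * truncation _ N.+1 n) /truncation /= !ltnS.
by case: ltngtP => [nN|Nn|->]; rewrite ?(ltn_eqF nN) ?eqxx ?mulr0 ?mulr1 ?addr0 ?add0r.
Qed.

Lemma rnorm_ell1_basis n : rnorm (ell1_basis n) = 1.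
Proof.
rewrite rnorm_ell1_truncation big_ord_recr /= eqxx big1 => [|i _].
  by rewrite add0r -(@scalar_of_real1 R k) rnorm_of_real.
by rewrite ltn_eqF// rnorm0.
Qed.

(** Continuity at 0 of the inverse [S] bounds [T] below; the sequence is the image
    of the unit vectors. *)
Lemma ell1_copy_sequence (G : normedModType K) : contains_copy_of_ell1 G ->
  exists (g : nat -> G) (M d : R),
  [/\ 0 < d, forall n, rnorm (g n) <= M & forall (a : nat -> K) N,
    d * \sum_(i < N) rnorm (a i) <= rnorm (\sum_(i < N) a i *: g i)].
Proof.
move=> [T [S [_ TS Sc]]].
have [M TM] := operator_bounded T.
have [d d0 dT] : exists2 d : R, 0 < d & forall a, rnorm (T a) < d -> rnorm a < 1.
  have rT0 : range T (T 0) by exists 0.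
  have near0 : @nbhs_subspace _ (range T) (T 0) [set t | `|S (T 0) - S t| < 1].
    by have /cvgrPdist_lt/(_ 1 ltr01) := Sc (T 0).
  rewrite -(nbhs_subspace_in rT0) TS linear0 in near0.
  move/nbhs_ballP: near0 => [e /= e0 eT]; exists (scalar_re e).
    by rewrite -(@ltr_scalar_of_real R k) scalar_of_real0 scalar_reK// ltW.
  move=> a Ta; have Tae : ball (0 : G) e (T a).
    rewrite -ball_normE /= sub0r normrN -rnormE -(scalar_reK (ltW e0)).
    by rewrite ltr_scalar_of_real.
  have /= := eT _ Tae (ex_intro2 _ _ a I erefl).
  rewrite TS sub0r normrN -rnormE -(@scalar_of_real1 R k).
  by rewrite ltr_scalar_of_real.
exists (fun n => T (ell1_basis n)), M, d; split=> // [n|a N].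
  by rewrite (le_trans (TM _))// rnorm_ell1_basis mulr1.
rewrite -rnorm_ell1_truncation.
have -> : \sum_(i < N) a i *: T (ell1_basis i) = T (ell1_truncation a N).
  by rewrite ell1_truncationE linear_sum; apply: eq_bigr => i _; rewrite linearZ.
set b := ell1_truncation a N; have [->|b0] := eqVneq b 0.
  by rewrite !linear0 !rnorm0 mulr0.
have nb0 : 0 < rnorm b.
  rewrite lt_neqAle rnorm_ge0 andbT eq_sym.
  by apply: contra b0 => /eqP/rnorm0_eq0/eqP.
rewrite leNgt; apply/negP => Tb.
have := dT (inj (rnorm b)^-1 *: b).
rewrite linearZ !rnormZ rnorm_of_real ?invr_ge0 ?rnorm_ge0//.
by rewrite mulVf ?gt_eqF// ltxx ltr_pdivrMl// mulrC => /(_ Tb).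
Qed.

End Ell1Copy.

(** * Functionals on the injective tensor product *)

Section TensorFunctionals.
Context {R : realType} {k : scalar_kind}.
Local Notation K := (scalars R k).

Lemma bounded_linearI (G H : normedModType K) (f : G -> H) (M : R) :
  linear f -> (forall x, rnorm (f x) <= M * rnorm x) -> f \in bounded_linear G H.
Proof. by move=> lf fM; apply/asboolP; split; last exists M. Qed.

Lemma rnorm_apply_le (G H : normedModType K) (f : operator G H) x :
  rnorm (f x) <= rnorm f * rnorm x.
Proof. by rewrite rnorm_operatorE ler_operator_norm. Qed.

Lemma pairing_bounded_linear (G H : normedModType K) (T : operator G (dual H)) y :
  (fun x => T x y : K) \in bounded_linear G K.
Proof.
apply: (@bounded_linearI _ _ _ (rnorm T * rnorm y)) => [a p q|p].
  by rewrite linearP.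
apply: le_trans (rnorm_apply_le (T p) y) _.
by rewrite mulrAC ler_wpM2r ?rnorm_ge0// rnorm_apply_le.
Qed.

Definition pairing (G H : normedModType K) (T : operator G (dual H)) y : dual G :=
  Operator (pairing_bounded_linear T y).

Lemma dual_almost_attained (G : normedModType K) (g : dual G) (e : R) : 0 < e ->
  exists2 y, rnorm y <= 1 & rnorm g - e <= scalar_re (g y : K).
Proof.
move=> e0; have [_ [y /= y1 <-] gy] := sup_adherent e0 (operator_norm_has_sup g).
have [a a1 ay] := scalar_rotation (g y).
exists (a *: y); first by rewrite rnormZ mulr_ile1 ?rnorm_ge0.
by rewrite linearZ/= [_ *: _]ay scalar_of_realK ltW// rnorm_operatorE.
Qed.

Lemma rnorm_evaluation (G : normedModType K) (y : G) :
  rnorm (evaluation y) <= rnorm y.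
Proof.
rewrite rnorm_operatorE; apply: operator_norm_le => [|g]; first exact: rnorm_ge0.
by rewrite mulrC; exact: (rnorm_apply_le g y).
Qed.

Variables E F : normedModType K.
Local Notation X := (injective_tensor_product E F).

Lemma rank_one_bounded_linear (phi : dual E) (psi : dual F) :
  (fun u : X => bilinear_form_of u phi psi : K) \in bounded_linear X K.
Proof.
apply: (@bounded_linearI _ _ _ (rnorm phi * rnorm psi)) => [a u v|u].
  have -> : bilinear_form_of (a *: u + v) = a *: bilinear_form_of u + bilinear_form_of v.
    by [].
  by rewrite !operatorDE !operatorZE.
apply: le_trans (rnorm_apply_le (bilinear_form_of u phi) psi) _.
rewrite -mulrA [leRHS]mulrCA mulrC ler_wpM2l ?rnorm_ge0// mulrC.
exact: (rnorm_apply_le (bilinear_form_of u) phi).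
Qed.

Definition rank_one phi psi : dual X := Operator (rank_one_bounded_linear phi psi).

Lemma elementary_tensor_injective (x : E) (y : F) :
  elementary_tensor x y \in injective_tensor E F.
Proof.
apply/asboolP; apply: subset_closure; exists [:: (x, y)] => //.
by rewrite /finite_tensor big_seq1.
Qed.

Definition pure_tensor x y : X := InjectiveTensor (elementary_tensor_injective x y).

Lemma pure_tensorDr x a y y' :
  pure_tensor x (a *: y + y') = a *: pure_tensor x y + pure_tensor x y'.
Proof.
apply/val_inj/operatorPE => phi; apply/operatorPE => psi /=.
rewrite -[RHS]/(a * (phi x * psi y) + phi x * psi y' : K).
by rewrite -[LHS]/(phi x * psi (a *: y + y') : K) linearP/= mulrDr mulrCA.
Qed.

Lemma pure_tensorDl a x x' y :
  pure_tensor (a *: x + x') y = a *: pure_tensor x y + pure_tensor x' y.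
Proof.
apply/val_inj/operatorPE => phi; apply/operatorPE => psi /=.
rewrite -[RHS]/(a * (phi x * psi y) + phi x' * psi y : K).
by rewrite -[LHS]/(phi (a *: x + x') * psi y : K) linearP/= mulrDl mulrA.
Qed.

Lemma rnorm_tensor_sum_le (I : Type) (r : seq I) (x : I -> E) (y : I -> F) (B : R) :
  (forall i, rnorm (y i) <= 1) ->
  (forall phi : dual E, rnorm phi <= 1 -> \sum_(i <- r) rnorm (phi (x i) : K) <= B) ->
  rnorm (\sum_(i <- r) pure_tensor (x i) (y i)) <= B.
Proof.
move=> y1 xB; set t := \sum_(i <- r) _.
have tE : bilinear_form_of t = \sum_(i <- r) elementary_tensor (x i) (y i).
  by rewrite /t; elim/big_ind2: _ => // u v u' v' <- <-.
rewrite -[leLHS]/(rnorm (bilinear_form_of t)) rnorm_operatorE.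
apply: ge_sup; first by have [] := operator_norm_has_sup (bilinear_form_of t).
move=> _ [phi /= phi1 <-]; apply: le_trans (xB _ phi1).
rewrite tE operator_sumE (le_trans (ler_rnorm_sum _ _ _))// ler_sum// => i _.
rewrite [X in rnorm X](_ : _ = (phi (x i) : K) *: evaluation (y i))//.
by rewrite rnormZ ler_piMr ?rnorm_ge0// (le_trans (rnorm_evaluation _)).
Qed.

Lemma rnorm_pure_tensor x y : rnorm (pure_tensor x y) <= rnorm x * rnorm y.
Proof.
rewrite -[leLHS]/(rnorm (elementary_tensor x y)) rnorm_operatorE.
apply: operator_norm_le => [|phi]; first by rewrite mulr_ge0 ?rnorm_ge0.
rewrite [X in rnorm X](_ : _ = (phi x : K) *: evaluation y)//.
rewrite rnormZ mulrAC ler_pM ?rnorm_ge0 ?rnorm_evaluation//.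
by rewrite mulrC rnorm_apply_le.
Qed.

Lemma slice_bounded_linear (u : dual X) (x : E) :
  (fun y => u (pure_tensor x y) : K) \in bounded_linear F K.
Proof.
apply: (@bounded_linearI _ _ _ (rnorm u * rnorm x)) => [a y y'|y].
  by rewrite pure_tensorDr linearP.
apply: le_trans (rnorm_apply_le u (pure_tensor x y)) _.
by rewrite -mulrA ler_wpM2l ?rnorm_ge0// rnorm_pure_tensor.
Qed.

(** A functional on the tensor product is integral as an operator from [E] to
    [dual F]; this is that operator. *)
Definition slice (u : dual X) (x : E) : dual F := Operator (slice_bounded_linear u x).

Lemma slice_linear u : linear (slice u).
Proof.
by move=> a x x'; apply/operatorPE => y /=; rewrite pure_tensorDl linearP.
Qed.

HB.instance Definition _ u :=
  GRing.isLinear.Build K E (dual F) *:%R (slice u) (slice_linear u).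

Lemma rnorm_slice u x : rnorm (slice u x) <= rnorm u * rnorm x.
Proof.
rewrite rnorm_operatorE; apply: operator_norm_le => [|y].
  by rewrite mulr_ge0 ?rnorm_ge0.
apply: le_trans (rnorm_apply_le u (pure_tensor x y)) _.
by rewrite -mulrA ler_wpM2l ?rnorm_ge0// rnorm_pure_tensor.
Qed.

(** Each norm on the left is almost attained at some [y i] of the unit ball of [F],
    so the sum is almost [u] applied to the tensor [sum x_i (x) y_i], whose
    injective norm is at most [B]. *)
Lemma slice_absolutely_summing (u : dual X) (I : Type) (r : seq I) (x : I -> E) (B : R) :
  (forall phi : dual E, rnorm phi <= 1 -> \sum_(i <- r) rnorm (phi (x i) : K) <= B) ->
  \sum_(i <- r) rnorm (slice u (x i)) <= rnorm u * B.
Proof.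
move=> xB; apply/ler_addgt0Pr => e e0.
pose e' := e / (size r).+1%:R; have e'0 : 0 < e' by rewrite divr_gt0.
have [y y1 uy] : exists2 y : I -> F, forall i, rnorm (y i) <= 1 &
    forall i, rnorm (slice u (x i)) - e' <= scalar_re (slice u (x i) (y i) : K).
  have [y yP] := @choice _ _ (fun i y => rnorm y <= 1 /\
      rnorm (slice u (x i)) - e' <= scalar_re (slice u (x i) y : K))
    (fun i => let: ex_intro2 y y1 uy := dual_almost_attained (slice u (x i)) e'0 in
      ex_intro _ y (conj y1 uy)).
  by exists y => i; have [] := yP i.
pose t := \sum_(i <- r) pure_tensor (x i) (y i).
have ut : \sum_(i <- r) (rnorm (slice u (x i)) - e') <= scalar_re (u t : K).
  have re0 : scalar_re (0 : K) = 0.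
    by have := scalar_reMl 0 (0 : K); rewrite mulr0 mul0r.
  by rewrite linear_sum (big_morph _ (@scalar_reD R k) re0) ler_sum.
have ub : scalar_re (u t : K) <= rnorm u * B.
  apply: le_trans (scalar_re_le_rnorm _) _; apply: le_trans (rnorm_apply_le _ _) _.
  by rewrite ler_wpM2l ?rnorm_ge0//; exact: rnorm_tensor_sum_le.
have := le_trans ut ub; rewrite big_split/= sumrN.
rewrite big_const_seq count_predT iter_addr_0 lerBlDr => /le_trans; apply.
rewrite lerD2l -mulr_natr /e' mulrAC ler_pdivrMr// ler_wpM2l ?(ltW e0)//.
by rewrite ler_nat.
Qed.

End TensorFunctionals.

(** * Finitely supported sequences under the l_1 norm *)

Section PolynomialEll1.
Context (R : realType) (k : scalar_kind).
Local Notation K := (scalars R k).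
Local Notation inj := (@scalar_of_real R k).

(** The finitely supported sequences under the l_1 norm; their dual is l_oo, which
    is complete although this space is not. *)
Definition poly_ell1 := {poly K}.

HB.instance Definition _ := GRing.Lmodule.copy poly_ell1 {poly K}.

Implicit Types w : poly_ell1.

Local Notation coef w i := (nth (0 : K) (polyseq (w : {poly K})) i).

Definition poly_ell1_norm w : R :=
  \sum_(i < size (w : {poly K})) rnorm (coef w i).

Lemma poly_ell1_norm_widen w N : (size (w : {poly K}) <= N)%N ->
  poly_ell1_norm w = \sum_(i < N) rnorm (coef w i).
Proof.
move=> wN; rewrite /poly_ell1_norm (big_ord_widen _ (fun i => rnorm (coef w i)) wN).
rewrite big_mkcond/=; apply: eq_bigr => i _; case: ltnP => // wi.
by rewrite nth_default// rnorm0.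
Qed.

Lemma poly_ell1_normD w w' :
  inj (poly_ell1_norm (w + w')) <= inj (poly_ell1_norm w) + inj (poly_ell1_norm w').
Proof.
rewrite -scalar_of_realD ler_scalar_of_real.
pose N := maxn (size (w : {poly K})) (size (w' : {poly K})).
rewrite (@poly_ell1_norm_widen w N) ?leq_maxl//.
rewrite (@poly_ell1_norm_widen w' N) ?leq_maxr//.
rewrite (@poly_ell1_norm_widen (w + w') N) ?size_polyD//.
rewrite -big_split ler_sum// => i _ /=.
by rewrite coefD; exact: ler_rnormD.
Qed.

Lemma poly_ell1_normZ (a : K) w :
  inj (poly_ell1_norm (a *: w)) = `|a| * inj (poly_ell1_norm w).
Proof.
rewrite -(rnormE a) -scalar_of_realM; congr (inj _).
rewrite (@poly_ell1_norm_widen _ (size (w : {poly K}))) ?size_scale_leq//.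
rewrite [in RHS]/poly_ell1_norm mulr_sumr; apply: eq_bigr => i _.
by rewrite coefZ -rnormZ.
Qed.

Lemma poly_ell1_norm0_eq0 w : inj (poly_ell1_norm w) = 0 -> w = 0.
Proof.
rewrite -(@scalar_of_real0 R k) => /(can_inj (@scalar_of_realK R k)) /eqP.
rewrite psumr_eq0 => [/allP w0|i _]; last exact: rnorm_ge0.
apply/polyP => i; rewrite coef0.
have [wi|iw] := leqP (size (w : {poly K})) i; first by rewrite nth_default.
have := w0 (Ordinal iw); rewrite mem_index_enum => /(_ isT) /eqP.
exact: rnorm0_eq0.
Qed.

HB.instance Definition _ := Lmodule_isNormed.Build K poly_ell1
  poly_ell1_normD poly_ell1_normZ poly_ell1_norm0_eq0.

Implicit Types g : dual poly_ell1.

Lemma rnorm_poly_ell1 w : rnorm w = poly_ell1_norm w.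
Proof. exact: scalar_of_realK. Qed.

Definition monomial (n : nat) : poly_ell1 := 'X^n.

Lemma poly_ell1E w N : (size (w : {poly K}) <= N)%N ->
  w = \sum_(i < N) coef w i *: monomial i.
Proof.
move=> wN; apply/polyP => i; rewrite coef_sum.
rewrite -[LHS]/(coef w i).
transitivity (\sum_(j < N) if j == i :> nat then coef w i else 0).
  have [iN|Ni] := ltnP i N.
    by rewrite -(big_mkcond (fun j : 'I_N => j == i :> nat)) (big_pred1 (Ordinal iN)).
  rewrite nth_default ?(leq_trans wN)// big1// => j _; case: eqP => //.
apply: eq_bigr => j _; rewrite coefZ coefXn.
by case: (eqVneq (i : nat) j) => [->|]; rewrite ?eqxx ?mulr1// mulr0.
Qed.

Lemma dual_poly_ell1E g w N : (size (w : {poly K}) <= N)%N ->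
  g w = \sum_(i < N) coef w i * g (monomial i).
Proof.
move=> wN; rewrite {1}(poly_ell1E wN) linear_sum; apply: eq_bigr => i _.
by rewrite linearZ.
Qed.

Lemma rnorm_monomial n : rnorm (monomial n) = 1.
Proof.
rewrite rnorm_poly_ell1 (@poly_ell1_norm_widen _ n.+1) ?size_polyXn//.
rewrite big_ord_recr/= coefXn eqxx big1 => [|i _].
  by rewrite add0r -(@scalar_of_real1 R k) rnorm_of_real.
by rewrite coefXn ltn_eqF// rnorm0.
Qed.

(** The hypothesis is the inhomogeneous form of the bound of [g] by [C] times the
    l_2 norm; it is tested on the sequence of the conjugates of [g (monomial i)],
    divided by [C]. *)
Lemma dual_poly_ell1_square_sum g (C : R) : 0 < C ->
  (forall w, rnorm (g w : K) <=
    C / 2 * (\sum_(i < size (w : {poly K})) rnorm (coef w i) ^+ 2 + 1)) ->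
  forall N, \sum_(i < N) rnorm (g (monomial i) : K) ^+ 2 <= C ^+ 2.
Proof.
move=> C0 gC N; set q := \sum_(i < N) _.
pose b i : K := g (monomial i).
(* [`|z| ^+ 2 / z] is the conjugate of [z], and 0 if [z = 0]. *)
pose w : {poly K} := \poly_(i < N) (inj C^-1 * (`|b i| ^+ 2 / b i)).
have wN : (size w <= N)%N by exact: size_poly.
have gw : rnorm (g w : K) = C^-1 * q.
  rewrite (dual_poly_ell1E g wN) -[RHS](@rnorm_of_real R k); last first.
    rewrite mulr_ge0 ?invr_ge0 ?(ltW C0) ?sumr_ge0// => i _.
    by rewrite exprn_ge0 ?rnorm_ge0.
  congr rnorm; rewrite scalar_of_realM.
  rewrite (big_morph _ (@scalar_of_realD R k) (@scalar_of_real0 R k)) mulr_sumr.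
  apply: eq_bigr => i _; rewrite coef_poly ltn_ord -mulrA; congr (_ * _).
  rewrite !expr2 scalar_of_realM rnormE -/(b i).
  have [->|bi0] := eqVneq (b i) 0; last by rewrite divfK.
  by rewrite mulr0 normr0 mulr0.
have ww : \sum_(i < size w) rnorm (coef w i) ^+ 2 <= C^-2 * q.
  apply: (@le_trans _ _ (\sum_(i < N) rnorm (coef w i) ^+ 2)).
    rewrite (big_ord_widen _ (fun i => rnorm (coef w i) ^+ 2) wN) big_mkcond/=.
    by apply: ler_sum => i _; case: ifP => // _; rewrite sqr_ge0.
  rewrite mulr_sumr; apply: ler_sum => i _; rewrite coef_poly ltn_ord.
  rewrite -[X in rnorm X]/(inj C^-1 *: (`|b i| ^+ 2 / b i : K)) rnormZ.
  rewrite rnorm_of_real ?invr_ge0 ?(ltW C0)// exprMn exprVn ler_wpM2l//.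
    by rewrite invr_ge0 exprn_ge0// ltW.
  have [bi0|bi0] := eqVneq (b i) 0.
    by rewrite bi0 invr0 mulr0 rnorm0 expr0n/= sqr_ge0.
  rewrite (_ : rnorm _ = rnorm (b i))//.
  apply: (can_inj (@scalar_of_realK R k)); rewrite !rnormE normrM normfV.
  by rewrite normrX normr_id expr2 mulfK ?normr_eq0.
have := gC w; rewrite gw.
have Ci : C * C^-1 = 1 by rewrite divff ?gt_eqF.
move=> h; have h1 : C^-1 * q <= C / 2 * (C^-2 * q + 1).
  by rewrite (le_trans h)// ler_wpM2l ?lerD2r// divr_ge0// ltW.
rewrite -(ler_pM2l (_ : 0 < C^-1 / 2)) ?divr_gt0 ?invr_gt0//.
have -> : C^-1 / 2 * C ^+ 2 = C / 2.
  by rewrite expr2 mulrAC !mulrA [C^-1 * C]mulrC Ci mul1r.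
have : C / 2 * (C^-2 * q + 1) = C^-1 * q / 2 + C / 2.
  by field; rewrite gt_eqF.
move=> E; rewrite E in h1; lra.
Qed.

End PolynomialEll1.

(** * Weak convergence *)

Section WeakCompactness.
Context {R : realType} {k : scalar_kind}.
Local Notation K := (scalars R k).

Lemma compact_disc_cover (M : R) :
  exists2 A : set K, compact A & [set z : K | rnorm z <= M] `<=` A.
Proof.
rewrite /rnorm /scalars /scalar_re; case: k.
  exists `[- M, M]%classic; [exact: segment_compact|move=> x /=].
  by rewrite in_itv/= ler_norml.
pose f (z : R * R) : R[i]%C := Complex z.1 z.2.
exists (f @` (`[- M, M] `*` `[- M, M])); last first.
  move=> z /= zM.
  have zE : `|z| = real_complex R (complex.Re `|z|).
    by apply/esym/RRe_real/ger0_real.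
  have zr : `|complex.Re z| <= M.
    by rewrite (le_trans _ zM)// -lecR -zE normc_ge_Re.
  have zi : `|complex.Im z| <= M.
    rewrite (le_trans _ zM)// -lecR -zE [leRHS]normc_def lecR.
    by rewrite -sqrtr_sqr ler_wsqrtr// lerDr sqr_ge0.
  exists (complex.Re z, complex.Im z); last by rewrite /f; case: z {zM zE zr zi}.
  by split; rewrite /= in_itv /= -ler_norml.
apply: continuous_compact; last by apply: compact_setX; exact: segment_compact.
apply: continuous_subspaceT => z.
apply/cvgrPdist_le => e e0.
have eE : e = real_complex R (complex.Re e).
  by apply/esym/RRe_real; rewrite gtr0_real.
have re0 : 0 < complex.Re e by rewrite -ltcR -eE.
have re20 : 0 < complex.Re e / 2 by rewrite divr_gt0.
have h1 : \forall t \near nbhs z, `|z.1 - t.1| <= complex.Re e / 2.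
  have c : fst @ nbhs z --> z.1 by exact: cvg_fst.
  by have /cvgrPdist_le/(_ _ re20) := c.
have h2 : \forall t \near nbhs z, `|z.2 - t.2| <= complex.Re e / 2.
  have c : snd @ nbhs z --> z.2 by exact: cvg_snd.
  by have /cvgrPdist_le/(_ _ re20) := c.
near=> t.
rewrite eE normc_def lecR /= -[leRHS]ger0_norm ?(ltW re0)// -sqrtr_sqr ler_wsqrtr//.
have t1 : `|z.1 - t.1| <= complex.Re e / 2 by near: t.
have t2 : `|z.2 - t.2| <= complex.Re e / 2 by near: t.
rewrite -(real_normK (num_real (z.1 - t.1))) -(real_normK (num_real (z.2 - t.2))).
have := normr_ge0 (z.1 - t.1); have := normr_ge0 (z.2 - t.2); nra.
Unshelve. all: by end_near. Qed.

Lemma bounded_ultrafilter_cvg (T : Type) (U : set_system T) (f : T -> K) (M : R) :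
  UltraFilter U -> U [set t | rnorm (f t) <= M] -> cvg (f @ U).
Proof.
move=> UU UM; have [A cA MA] := compact_disc_cover M.
have UA : U (f @^-1` A) by apply: filterS UM => t /MA.
have PU : ProperFilter (f @ U) by apply: fmap_proper_filter; exact: ultra_proper.
have [l [_ fl]] := cA (f @ U) PU UA.
apply: (cvgP l) => B Bl; have [//|UB] := in_ultra_setVsetC (f @^-1` B) UU.
by have [z [nBz /nBz]] := fl _ _ (UB : (f @ U) (~` B)) Bl.
Qed.

Lemma rnorm_cvg (T : Type) (U : set_system T) {FU : Filter U} (f : T -> K) (l : K) :
  f @ U --> l -> (fun t => rnorm (f t)) @ U --> rnorm l.
Proof.
move=> /rnorm_cvgP fl; apply/cvgrPdist_le => e e0.
have Ue : U [set t | rnorm (l - f t) <= e] by exact: fl.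
apply: filterS Ue => t /= lt; rewrite ler_norml.
have := ler_rnormD (l - f t) (f t); rewrite subrK.
have := ler_rnormD (f t - l) l; rewrite subrK -[rnorm (f t - l)]rnormN opprB.
by move: lt; lra.
Qed.

Lemma weak_cvgI (Z : normedModType K) (U : set_system Z) (l : Z) : Filter U ->
  (forall f : dual Z, (fun z => f z : K) @ U --> (f l : K)) ->
  U --> (l : weak_topology Z).
Proof.
move=> FU Ul B [_ [[A oA <-] /= Al] AB].
apply: filterS AB _; pose ev (z : Z) : {ptws dual Z -> K} := fun f => f z.
have : ev @ U --> ev l by apply/pointwise_cvgP => f; exact: Ul.
by apply; apply: open_nbhs_nbhs.
Qed.

Lemma weak_cvgE (Z : normedModType K) (U : set_system Z) (l : Z) : Filter U ->
  U --> (l : weak_topology Z) ->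
  forall f : dual Z, (fun z => f z : K) @ U --> (f l : K).
Proof.
move=> FU Ul f; pose ev (z : Z) : {ptws dual Z -> K} := fun f => f z.
have : ev @ U --> ev l.
  apply: cvg_trans (@initial_continuous Z {ptws dual Z -> K} ev l).
  exact: cvg_app.
by move/pointwise_cvgP; apply.
Qed.

Lemma bounded_partial_sums_tail (t : nat -> R) (B e : R) : 0 < e ->
  (forall n, 0 <= t n) -> (forall N, \sum_(i < N) t i <= B) ->
  exists M, forall N, (M <= N)%N -> \sum_(M <= i < N) t i <= e.
Proof.
move=> e0 t0 tB; pose A := range (fun N => \sum_(i < N) t i).
have sA : has_sup A.
  split; first by exists (\sum_(i < 0) t i), 0%N.
  by exists B => _ [N _ <-].
have [_ [M _ <-] hM] := sup_adherent e0 sA; exists M => N MN.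
have : \sum_(i < N) t i <= sup A by apply: sup_upper_bound => //; exists N.
rewrite -(big_mkord xpredT t) (@big_cat_nat _ _ _ M)//= big_mkord.
by move: hM; lra.
Qed.

End WeakCompactness.

(** * Weak compactness of l_2 balls in l_oo *)

Section SquareSummableBall.
Context {R : realType} {k : scalar_kind}.
Local Notation K := (scalars R k).
Local Notation inj := (@scalar_of_real R k).
Local Notation Y := (poly_ell1 R k).
Local Notation coef w i := (nth (0 : K) (polyseq (w : {poly K})) i).
Local Notation mono n := (monomial R k n).
Implicit Types (w : Y) (g : dual Y).

Lemma rnorm_dual_poly_ell1_le g (B : R) : 0 <= B ->
  (forall i, rnorm (g (mono i) : K) <= B) -> rnorm g <= B.
Proof.
move=> B0 gB; rewrite rnorm_operatorE; apply: operator_norm_le => // w.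
rewrite (dual_poly_ell1E g (leqnn _)) (le_trans (ler_rnorm_sum _ _ _))//.
rewrite rnorm_poly_ell1 mulr_sumr ler_sum// => i _.
rewrite -[X in rnorm X]/(coef w i *: (g (mono i) : K)) rnormZ mulrC.
by rewrite ler_wpM2r ?rnorm_ge0.
Qed.

Lemma coefficient_bounded_linear n :
  (fun w : Y => coef w n : K) \in bounded_linear Y K.
Proof.
apply: (@bounded_linearI _ _ _ _ _ 1) => [a v w|w].
  by rewrite coefD coefZ.
rewrite mul1r rnorm_poly_ell1.
rewrite (@poly_ell1_norm_widen _ _ _ (maxn (size (w : {poly K})) n.+1)).
  rewrite (bigD1 (Ordinal (leq_maxr _ n.+1)))//= lerDl sumr_ge0// => i _.
  exact: rnorm_ge0.
exact: leq_maxl.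
Qed.

Definition coefficient n : dual Y := Operator (coefficient_bounded_linear n).

Definition partial_sum (b : nat -> K) N : dual Y :=
  \sum_(i < N) b i *: coefficient i.

Lemma partial_sumE b N i :
  partial_sum b N (mono i) = (if (i < N)%N then b i else 0).
Proof.
rewrite operator_sumE.
transitivity (\sum_(j < N) if j == i :> nat then b j else 0).
  apply: eq_bigr => j _; rewrite operatorZE -[X in _ *: X]/(coef (mono i) j) coefXn.
  by case: eqP => _; rewrite /GRing.scale/= ?mulr1 ?mulr0.
have [iN|Ni] := ltnP i N.
  by rewrite -(big_mkcond (fun j : 'I_N => j == i :> nat)) (big_pred1 (Ordinal iN)).
rewrite big1// => j _; case: eqP => // ji.
by have := ltn_ord j; rewrite ji ltnNge Ni.
Qed.

(** Test [f] on a sequence of scalars of modulus at most 1 that rotate its values at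
    the coefficient functionals to the nonnegative reals. *)
Lemma bidual_coefficient_sum (f : dual (dual Y)) N :
  \sum_(i < N) rnorm (f (coefficient i) : K) <= rnorm f.
Proof.
have [a aP] := @choice _ _ (fun i (a : K) => rnorm a <= 1 /\
    a * f (coefficient i) = inj (rnorm (f (coefficient i) : K)))
  (fun i => let: ex_intro2 a a1 af := scalar_rotation (f (coefficient i)) in
    ex_intro _ a (conj a1 af)).
have <- : rnorm (f (partial_sum a N) : K) = \sum_(i < N) rnorm (f (coefficient i) : K).
  rewrite -[RHS](@rnorm_of_real R k) ?sumr_ge0// => [|i _]; last exact: rnorm_ge0.
  congr rnorm; rewrite (big_morph _ (@scalar_of_realD R k) (@scalar_of_real0 R k)).
  by rewrite linear_sum; apply: eq_bigr => i _; rewrite linearZ/= [LHS](aP i).2.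
rewrite (le_trans (rnorm_apply_le _ _))// ler_piMr ?rnorm_ge0//.
apply: rnorm_dual_poly_ell1_le => // i; rewrite partial_sumE.
by case: ifP => _; [have [] := aP i|rewrite rnorm0].
Qed.

Definition square_summable_ball (C : R) : set (dual Y) :=
  [set g | forall N, \sum_(i < N) rnorm (g (mono i) : K) ^+ 2 <= C ^+ 2].

Variable C : R.
Hypothesis C0 : 0 < C.

Lemma square_summable_ball_coef g i :
  square_summable_ball C g -> rnorm (g (mono i) : K) <= C.
Proof.
move=> /(_ i.+1); rewrite big_ord_recr/= => h.
rewrite -(@ler_pXn2r _ 2) ?nnegrE ?rnorm_ge0 ?(ltW C0)//.
by apply: le_trans h; rewrite lerDr sumr_ge0// => j _; rewrite sqr_ge0.
Qed.

(** Elements of an l_2 ball tend to 0, so they are norm limits in l_oo of their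
    truncations. *)
Lemma square_summable_ball_tail g e : square_summable_ball C g -> 0 < e ->
  exists M, forall N, (M <= N)%N -> rnorm (g - partial_sum (fun i => g (mono i)) N) <= e.
Proof.
move=> Wg e0; have [||M hM] := @bounded_partial_sums_tail R
    (fun i => rnorm (g (mono i) : K) ^+ 2) (C ^+ 2) (e ^+ 2) (exprn_gt0 2 e0).
- by move=> n; rewrite sqr_ge0.
- exact: Wg.
exists M => N MN; apply: rnorm_dual_poly_ell1_le => [|i]; first exact: ltW.
rewrite -[X in rnorm X]/(g (mono i) - partial_sum _ N (mono i)) partial_sumE.
case: ltnP => [_|Ni]; first by rewrite subrr rnorm0 ltW.
rewrite subr0 -(@ler_pXn2r _ 2) ?nnegrE ?rnorm_ge0 ?(ltW e0)//.
have Mi : (M <= i)%N by exact: leq_trans Ni.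
apply: le_trans (hM i.+1 (leqW Mi)).
by rewrite big_nat_recr//= lerDr sumr_ge0// => j _; rewrite sqr_ge0.
Qed.

(** As [g] is the limit of its truncations, [f g] is the sum of the products of the
    entries of [g] and the values of [f] at the coefficient functionals.  The
    former are bounded by [C] and the latter absolutely summable, so [f] is
    approximated on the whole ball by one finite combination of entries: there,
    weak and coordinatewise convergence agree. *)
Lemma square_summable_ball_uniform (f : dual (dual Y)) e : 0 < e ->
  exists M, forall g, square_summable_ball C g ->
    rnorm (f g - \sum_(i < M) g (mono i) * f (coefficient i) : K) <= e.
Proof.
move=> e0; have [||M hM] := @bounded_partial_sums_tail R
    (fun i => rnorm (f (coefficient i) : K)) (rnorm f) (e / C) (divr_gt0 e0 C0).
- by move=> n; exact: rnorm_ge0.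
- exact: bidual_coefficient_sum.
exists M => g Wg; apply/ler_addgt0Pr => d d0.
pose b i := g (mono i).
have d'0 : 0 < d / (rnorm f + 1) by rewrite divr_gt0// ltr_wpDl ?rnorm_ge0.
have [M' hM'] := square_summable_ball_tail Wg d'0.
pose N := maxn M M'.
have fE n : f (partial_sum b n) = \sum_(i < n) b i * f (coefficient i).
  by rewrite linear_sum; apply: eq_bigr => i _; rewrite linearZ.
have -> : f g - \sum_(i < M) g (mono i) * f (coefficient i) =
    f (g - partial_sum b N) + \sum_(M <= i < N) b i * f (coefficient i).
  rewrite linearB/= fE -[\sum_(i < N) _](big_mkord xpredT (fun i => b i * f (coefficient i))).
  rewrite (@big_cat_nat _ _ _ M)//= ?leq_maxl// big_mkord opprD addrA.
  by rewrite subrK.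
rewrite (le_trans (ler_rnormD _ _))// addrC lerD//.
  rewrite (le_trans (ler_rnorm_sum _ _ _))//.
  have := hM N (leq_maxl _ _); rewrite ler_pdivlMr// mulrC => h.
  apply: le_trans h; rewrite mulr_sumr ler_sum// => i _.
  rewrite -[X in rnorm X]/(b i *: (f (coefficient i) : K)) rnormZ.
  by rewrite ler_wpM2r ?rnorm_ge0// square_summable_ball_coef.
rewrite (le_trans (rnorm_apply_le _ _))//.
rewrite (le_trans (ler_wpM2l (rnorm_ge0 f) (hM' N (leq_maxr _ _))))//.
rewrite mulrCA ler_piMr ?(ltW d0)// ler_pdivrMr ?ltr_wpDl ?rnorm_ge0//.
by rewrite mul1r lerDl.
Qed.

Lemma square_sum_cvg (U : set_system (dual Y)) {FU : Filter U} (l : dual Y) N :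
  (forall i, (fun g : dual Y => g (mono i) : K) @ U --> (l (mono i) : K)) ->
  (fun g : dual Y => \sum_(i < N) rnorm (g (mono i) : K) ^+ 2) @ U -->
  \sum_(i < N) rnorm (l (mono i) : K) ^+ 2.
Proof.
move=> Ul; apply: cvg_big => [|i _]; first exact: add_continuous.
by rewrite expr2; under eq_fun do rewrite expr2; apply: cvgM; exact: rnorm_cvg.
Qed.

Lemma square_summable_ball_weakly_closed :
  closed (square_summable_ball C : set (weak_topology (dual Y))).
Proof.
move=> l Wl N; pose nbhs_l : set_system (dual Y) := @nbhs _ (weak_topology (dual Y)) l.
have FF : Filter nbhs_l := nbhs_filter (l : weak_topology (dual Y)).
pose U : set_system (dual Y) := within (square_summable_ball C) nbhs_l.
have PU : ProperFilter U by exact: (within_nbhs_proper Wl).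
have Ul : U --> (l : weak_topology (dual Y)).
  by move=> B lB; apply: (@filterS _ nbhs_l _ _ _ _ lB) => g Bg _.
have Ule (f : dual (dual Y)) : (fun g => f g : K) @ U --> (f l : K).
  exact: weak_cvgE.
have h := @square_sum_cvg U (@filter_filter _ U PU) l N
  (fun i => Ule (evaluation (mono i))).
apply: (cvgr_to_le h); apply: (@filterE _ nbhs_l) => g Wg; exact: Wg.
Qed.

(** An ultrafilter on the ball converges pointwise, by compactness of discs, to an
    element of the ball, hence weakly by [square_summable_ball_uniform]. *)
Lemma square_summable_ball_weakly_compact :
  compact (square_summable_ball C : set (weak_topology (dual Y))).
Proof.
rewrite compact_ultra => U UU UW.
have PU : ProperFilter U by exact: ultra_proper.
have gw g w : square_summable_ball C g -> rnorm (g w : K) <= C * rnorm w.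
  move=> Wg; rewrite (le_trans (rnorm_apply_le _ _))// ler_wpM2r ?rnorm_ge0//.
  by apply: rnorm_dual_poly_ell1_le => [|i]; [exact: ltW|exact: square_summable_ball_coef].
have cv w : cvg ((fun g : dual Y => g w : K) @ U).
  apply: (@bounded_ultrafilter_cvg _ _ _ _ _ (C * rnorm w)).
  by apply: filterS UW => g /gw; exact.
pose l w : K := lim ((fun g : dual Y => g w : K) @ U).
have lE w : (fun g : dual Y => g w : K) @ U --> l w by exact: cv.
have lbl : l \in bounded_linear Y K.
  apply: (@bounded_linearI _ _ _ _ _ C) => [a v w|w].
    apply/cvg_lim => //=.
    rewrite (_ : (fun g : dual Y => _) = (fun g : dual Y => a *: (g v : K) + g w)).
      exact: cvgD (cvgZ (cvg_cst a) (lE v)) (lE w).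
    by apply/funext => g; rewrite linearP.
  apply: (cvgr_to_le (rnorm_cvg (lE w))).
  by apply: filterS UW => g /gw; exact.
pose L : dual Y := Operator lbl.
have WL : square_summable_ball C L.
  move=> N; apply: (cvgr_to_le (square_sum_cvg (l := L) (N := N) (fun i => lE (mono i)))).
  by apply: filterS UW => g; exact.
exists L; split=> //; apply: weak_cvgI => f.
apply/rnorm_cvgP => e e0.
have e30 : 0 < e / 3 by rewrite divr_gt0.
have [M hM] := square_summable_ball_uniform f e30.
have sc : (fun g : dual Y => \sum_(i < M) g (mono i) * f (coefficient i) : K) @ U -->
    \sum_(i < M) L (mono i) * f (coefficient i).
  apply: cvg_big => [|i _]; first exact: add_continuous.
  apply: cvgM; [exact: lE|exact: cvg_cst].
have {sc}/rnorm_cvgP/(_ _ e30) sc := sc.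
suff : U [set g : dual Y | rnorm (f L - f g : K) <= e] by [].
pose s g : K := \sum_(i < M) g (mono i) * f (coefficient i).
have sU : U [set g : dual Y | rnorm (s L - s g : K) <= e / 3] by exact: sc.
apply: filterS2 UW sU => g Wg /= Lg.
have -> : f L - f g = (f L - s L) + (s L - s g) - (f g - s g).
  by rewrite subrKA opprB addrC subrKA addrC.
rewrite (le_trans (ler_rnormD _ _))// rnormN.
rewrite (le_trans (lerD (ler_rnormD _ _) (lexx _)))//.
have := hM _ WL; have := hM _ Wg; rewrite -/(s L) -/(s g); lra.
Qed.

Lemma square_summable_ball_weakly_precompact :
  precompact (square_summable_ball C : set (weak_topology (dual Y))).
Proof.
rewrite precompact_closed; first exact: square_summable_ball_weakly_compact.
exact: square_summable_ball_weakly_closed.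
Qed.

End SquareSummableBall.

(** * The coordinate operator *)

HB.instance Definition _ (R : realType) (k : scalar_kind)
    (G : normedModType (scalars R k)) :=
  Uniform_isComplete.Build (dual G) (operator_complete (@scalars_complete R k)).

Section CoordinateOperator.
Context {R : realType} {k : scalar_kind}.
Local Notation K := (scalars R k).
Local Notation Y := (poly_ell1 R k).
Local Notation coef w i := (nth (0 : K) (polyseq (w : {poly K})) i).
Local Notation mono n := (monomial R k n).
Variables E F : normedModType K.
Local Notation X := (injective_tensor_product E F).
Variable x : nat -> E.
Hypothesis x1 : forall n, rnorm (x n) <= 1.

Definition scaled_slices (u : dual X) (w : Y) : rademacher_seq (dual F) :=
  poly_scaled (fun n => slice u (x n)) w.

Lemma scaled_slices_norm_l1 u w :
  rademacher_norm (scaled_slices u w) <= rnorm u * rnorm w.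
Proof.
apply: rademacher_norm_le => N; apply: le_trans (rademacher_mean_le _ N) _.
rewrite rnorm_poly_ell1 mulr_sumr.
apply: (@le_trans _ _ (\sum_(i < N) rnorm u * rnorm (coef w i))).
  apply: ler_sum => i _; rewrite rnormZ mulrC ler_wpM2r ?rnorm_ge0//.
  by rewrite (le_trans (rnorm_slice _ _))// ler_piMr ?rnorm_ge0.
apply: (@ler_sum_support _ (fun i => rnorm u * rnorm (coef w i))) => i.
  by rewrite mulr_ge0 ?rnorm_ge0.
by move=> wi; rewrite nth_default// rnorm0 mulr0.
Qed.

(** For [phi] in the unit ball, [|z| <= (|z| ^+ 2 + 1) / 2] reduces the mean of
    [|sum_i +-w_i phi (x i)|] to its second moment, and slicing is absolutely
    summing.  Unlike the Cauchy-Schwarz form, this bound needs no square root. *)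
Lemma scaled_slices_norm_l2 u w : rademacher_norm (scaled_slices u w) <=
  rnorm u * ((\sum_(i < size (w : {poly K})) rnorm (coef w i) ^+ 2 + 1) / 2).
Proof.
set Q := (_ / 2).
apply: rademacher_norm_le => N; rewrite /rademacher_mean /sign_mean.
pose z s := signed_sum (fun n => coef w n *: x n) N s.
have zE s : signed_sum (scaled_slices u w) N s = slice u (z s).
  rewrite /z /signed_sum linear_sum; apply: eq_bigr => i _.
  have sZ (c : K) v : slice u (c *: v) = c *: slice u v by rewrite linearZ.
  by rewrite /= !sZ.
under eq_bigr do rewrite zE.
rewrite mulrC ler_pdivrMr ?exprn_gt0// -mulrA.
apply: slice_absolutely_summing => phi phi1.
rewrite -ler_pdivrMr ?exprn_gt0// mulrC -/(sign_mean N (fun s => rnorm (phi (z s) : K))).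
pose f n : K := coef w n * phi (x n).
have phiz s : phi (z s) = 0 + signed_sum f N s.
  rewrite add0r /z /signed_sum linear_sum; apply: eq_bigr => i _.
  have pZ (c : K) v : phi (c *: v) = c * phi v by rewrite linearZ.
  by rewrite /= !pZ.
apply: (@le_trans _ _ (sign_mean N (fun s => 2^-1 * (rnorm (0 + signed_sum f N s) ^+ 2 + 1)))).
  apply: ler_sign_mean => s; rewrite phiz.
  by have := sqr_ge0 (rnorm (0 + signed_sum f N s) - 1); nra.
rewrite sign_meanZ sign_meanD sign_mean_cst sign_second_moment rnorm0 expr0n/= add0r.
rewrite /Q mulrC ler_wpM2r// lerD2r.
apply: (@le_trans _ _ (\sum_(i < N) rnorm (coef w i) ^+ 2)).
  apply: ler_sum => i _; rewrite lerXn2r ?nnegrE ?rnorm_ge0//.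
  rewrite -[X in rnorm X]/(coef w i *: (phi (x i) : K)) rnormZ.
  rewrite ler_piMr ?rnorm_ge0// (le_trans (rnorm_apply_le _ _))//.
  by rewrite mulr_ile1 ?rnorm_ge0.
apply: (@ler_sum_support _ (fun i => rnorm (coef w i) ^+ 2)) => i; first exact: sqr_ge0.
by move=> wi; rewrite nth_default// rnorm0 expr0n.
Qed.

Variables (d : R) (L : {scalar rademacher_seq (dual F)}).
Hypothesis d0 : 0 < d.
Hypothesis Ld : forall f, rnorm (L f : K) <= d^-1 * rademacher_norm f.

Lemma coordinates_of_bounded_linear u :
  (fun w => L (scaled_slices u w) : K) \in bounded_linear Y K.
Proof.
apply: (@bounded_linearI _ _ _ _ _ (d^-1 * rnorm u)) => [a v w|w].
  by rewrite /scaled_slices linearP linearP.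
rewrite (le_trans (Ld _))// -mulrA ler_wpM2l ?invr_ge0 ?(ltW d0)//.
exact: scaled_slices_norm_l1.
Qed.

Definition coordinates_of u : dual Y := Operator (coordinates_of_bounded_linear u).

Lemma coordinate_bounded_linear :
  coordinates_of \in bounded_linear (dual X) (dual Y).
Proof.
apply: (@bounded_linearI _ _ _ _ _ d^-1) => [a u v|u].
  apply/operatorPE => w; rewrite operatorDE operatorZE.
  rewrite -[LHS]/(L (scaled_slices (a *: u + v) w)).
  have -> : scaled_slices (a *: u + v) w = a *: scaled_slices u w + scaled_slices v w.
    apply/val_inj/funext => n /=.
    have -> : slice (a *: u + v) (x n) = a *: slice u (x n) + slice v (x n).
      by apply/operatorPE.
    rewrite -[RHS]/(a *: (coef w n *: slice u (x n)) + coef w n *: slice v (x n)).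
    by rewrite scalerDr !scalerA [in RHS]mulrC.
  by rewrite linearP.
rewrite rnorm_operatorE; apply: operator_norm_le => [|w].
  by rewrite mulr_ge0 ?invr_ge0 ?(ltW d0) ?rnorm_ge0.
rewrite (le_trans (Ld _))// -mulrA ler_wpM2l ?invr_ge0 ?(ltW d0)//.
exact: scaled_slices_norm_l1.
Qed.

Definition coordinate_operator : operator (dual X) (dual Y) :=
  Operator coordinate_bounded_linear.

Lemma coordinate_operator_weakly_compact :
  weakly_compact_operator coordinate_operator.
Proof.
have dV0 : 0 < d^-1 by rewrite invr_gt0.
apply: precompact_subset (square_summable_ball_weakly_precompact dV0).
move=> _ [u /= u1 <-]; apply: dual_poly_ell1_square_sum => // w.
have ru1 : rnorm u <= 1.
  by rewrite -(@ler_scalar_of_real R k) rnormE scalar_of_real1.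
rewrite (le_trans (Ld _))// -mulrA ler_wpM2l ?(ltW dV0)//.
rewrite (le_trans (scaled_slices_norm_l2 _ _))// mulrC [2^-1 * _]mulrC ler_piMr//.
by rewrite divr_ge0// addr_ge0// sumr_ge0// => i _; rewrite sqr_ge0.
Qed.

Lemma coordinate_rank_one (psi : nat -> dual F) (phi : dual E) n :
  (forall w, L (poly_scaled psi w) = w.[1]) ->
  coordinate_operator (rank_one phi (psi n)) (mono n) = phi (x n).
Proof.
move=> Lpsi; rewrite -[LHS]/(L (scaled_slices (rank_one phi (psi n)) (mono n))).
have -> : scaled_slices (rank_one phi (psi n)) (mono n) =
    (phi (x n) : K) *: poly_scaled psi 'X^n.
  apply/val_inj/funext => m /=.
  rewrite -[RHS]/((phi (x n) : K) *: (('X^n : {poly K})`_m *: psi m)) !coefXn.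
  have [->|_] := eqVneq m n; last by rewrite !scale0r scaler0.
  by rewrite !scale1r; apply/operatorPE.
by rewrite linearZ/= Lpsi hornerXn expr1n mulr1.
Qed.

End CoordinateOperator.

(** * Weakly null sequences of functionals of rank one *)

Section WeaklyNullRankOne.
Context {R : realType} {k : scalar_kind}.
Local Notation K := (scalars R k).

(** A norm limit is determined by the pointwise limits. *)
Lemma cauchy_pointwise_null (G : normedModType K) (g : nat -> dual G) :
  cauchy (g @ \oo) -> (forall y, (fun n => g n y : K) @ \oo --> (0 : K)) ->
  forall e : R, 0 < e -> \forall n \near \oo, rnorm (g n) <= e.
Proof.
move=> gc g0 e e0; have e20 : 0 < e / 2 by rewrite divr_gt0.
have [h hg] := rnorm_cauchyP _ gc e20.
have {}hg : \forall n \near \oo, rnorm (h - g n) <= e / 2 by exact: hg.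
near=> n; rewrite rnorm_operatorE; apply: operator_norm_le => [|y]; first exact: ltW.
apply/ler_addgt0Pr => c c0.
have /rnorm_cvgP/(_ _ c0) gy := g0 y.
have {}gy : \forall m \near \oo, rnorm (0 - g m y : K) <= c by exact: gy.
have [m [hm gm]] := filter_ex (filterI hg gy).
have hn : rnorm (h - g n) <= e / 2 by near: n.
have -> : g n y = (g n - g m) y - (0 - g m y) :> K.
  by rewrite -[(g n - g m) y]/(g n y - g m y) sub0r opprK subrK.
rewrite (le_trans (ler_rnormD _ _))// rnormN lerD//.
rewrite (le_trans (rnorm_apply_le _ _))// ler_wpM2r ?rnorm_ge0//.
have -> : g n - g m = (h - g m) - (h - g n) by rewrite opprB [RHS]addrC subrKA.
rewrite (le_trans (ler_rnormD _ _))// rnormN; move: hm hn => /=; lra.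
Unshelve. all: by end_near. Qed.

Variables E F : normedModType K.
Local Notation X := (injective_tensor_product E F).

Lemma rank_oneDl a (phi phi' : dual E) (psi : dual F) :
  rank_one (a *: phi + phi') psi = a *: rank_one phi psi + rank_one phi' psi.
Proof.
apply/operatorPE => u.
by rewrite -[LHS]/(bilinear_form_of u (a *: phi + phi') psi : K) linearP.
Qed.

Lemma rank_oneDr a (phi : dual E) (psi psi' : dual F) :
  rank_one phi (a *: psi + psi') = a *: rank_one phi psi + rank_one phi psi'.
Proof.
apply/operatorPE => u.
by rewrite -[LHS]/(bilinear_form_of u phi (a *: psi + psi') : K) linearP.
Qed.

Lemma rnorm_rank_one (phi : dual E) (psi : dual F) :
  rnorm (rank_one phi psi) <= rnorm phi * rnorm psi.
Proof.
rewrite rnorm_operatorE; apply: operator_norm_le => [|u].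
  by rewrite mulr_ge0 ?rnorm_ge0.
apply: le_trans (rnorm_apply_le (bilinear_form_of u phi) psi) _.
rewrite mulrAC ler_wpM2r ?rnorm_ge0// mulrC.
exact: (rnorm_apply_le (bilinear_form_of u) phi).
Qed.

Variable Xi : dual (dual X).

Lemma bidual_row_bounded_linear (phi : dual E) :
  (fun psi : dual F => Xi (rank_one phi psi) : K) \in bounded_linear (dual F) K.
Proof.
apply: (@bounded_linearI _ _ _ _ _ (rnorm Xi * rnorm phi)) => [a psi psi'|psi].
  by rewrite rank_oneDr linearP.
apply: le_trans (rnorm_apply_le Xi (rank_one phi psi)) _.
by rewrite -mulrA ler_wpM2l ?rnorm_ge0// rnorm_rank_one.
Qed.

Definition bidual_row phi : dual (dual F) := Operator (bidual_row_bounded_linear phi).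

Lemma bidual_matrix_bounded_linear :
  bidual_row \in bounded_linear (dual E) (dual (dual F)).
Proof.
apply: (@bounded_linearI _ _ _ _ _ (rnorm Xi)) => [a phi phi'|phi].
  apply/operatorPE => psi; rewrite operatorDE operatorZE.
  by rewrite -[LHS]/(Xi (rank_one _ psi) : K) rank_oneDl linearP.
rewrite rnorm_operatorE; apply: operator_norm_le => [|psi].
  by rewrite mulr_ge0 ?rnorm_ge0.
apply: le_trans (rnorm_apply_le Xi (rank_one phi psi)) _.
by rewrite -mulrA ler_wpM2l ?rnorm_ge0// rnorm_rank_one.
Qed.

(** The operator from [dual E] to the bidual of [F] that [Xi] induces through the
    functionals of rank one. *)
Definition bidual_matrix : operator (dual E) (dual (dual F)) :=
  Operator bidual_matrix_bounded_linear.

Lemma rank_one_weakly_null (phi : nat -> dual E) (psi : nat -> dual F) (M : R) :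
  completely_continuous bidual_matrix ->
  weakly_converges phi 0 -> (forall n, rnorm (psi n) <= M) ->
  (fun n => Xi (rank_one (phi n) (psi n)) : K) @ \oo --> (0 : K).
Proof.
move=> cc phi0 psiM; have M0 : 0 <= M by exact: le_trans (rnorm_ge0 _) (psiM 0%N).
have Tc : cauchy ((fun n => bidual_matrix (phi n)) @ \oo).
  by apply: cc => f; apply: cvg_cauchy; apply: cvgP (phi0 f).
have T0 (chi : dual F) : (fun n => bidual_matrix (phi n) chi : K) @ \oo --> (0 : K).
  by have := phi0 (pairing bidual_matrix chi); rewrite linear0.
apply/rnorm_cvgP => e e0.
have e'0 : 0 < e / (M + 1) by rewrite divr_gt0// ltr_wpDl.
have := cauchy_pointwise_null Tc T0 e'0; apply: filterS => n hn /=.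
rewrite sub0r rnormN.
apply: le_trans (rnorm_apply_le (bidual_matrix (phi n)) (psi n)) _.
apply: le_trans (ler_pM (rnorm_ge0 _) (rnorm_ge0 _) hn (psiM n)) _.
by rewrite mulrAC ler_pdivrMr ?ltr_wpDl// ler_pM2l// lerDl.
Qed.

End WeaklyNullRankOne.

(** * Failure of the Dunford-Pettis property *)

(** Translate a weakly convergent sequence that diverges in norm by its weak limit. *)
Lemma weakly_null_not_norm_null (R : realType) (k : scalar_kind)
    (G : normedModType (scalars R k)) : ~ schur_property G ->
  exists2 z : nat -> G, weakly_converges z 0 &
    ~ forall e : R, 0 < e -> \forall n \near \oo, rnorm (z n) <= e.
Proof.
move=> nS; apply/not_exists2P => h; apply: nS => z l zl.
have zl0 : weakly_converges (fun n => z n - l) 0.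
  move=> f; rewrite linear0 -(subrr (f l)).
  under eq_fun do rewrite linearB; exact: cvgB (zl f) (cvg_cst _).
have [//|/contrapT z0] := h (fun n => z n - l).
apply: (cvgP l); apply/rnorm_cvgP => e e0.
by have := z0 e e0; apply: filterS => n; rewrite -[_ - l]opprB rnormN.
Qed.

Lemma norming_vectors (R : realType) (k : scalar_kind)
    (G : normedModType (scalars R k)) (phi : nat -> dual G) :
  exists2 x : nat -> G, forall n, rnorm (x n) <= 1 &
    forall n, rnorm (phi n) <= 2 * rnorm (phi n (x n) : scalars R k).
Proof.
have pick n : exists y, rnorm y <= 1 /\
    rnorm (phi n) <= 2 * rnorm (phi n y : scalars R k).
  have [p0|p0] := eqVneq (rnorm (phi n)) 0.
    by exists 0; rewrite p0 rnorm0 ler01 mulr_ge0 ?rnorm_ge0.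
  have p20 : 0 < rnorm (phi n) / 2 by rewrite divr_gt0// lt_neqAle eq_sym p0 rnorm_ge0.
  have [y y1 py] := dual_almost_attained (phi n) p20; exists y; split=> //.
  by have := scalar_re_le_rnorm (phi n y); lra.
have [x xP] := choice pick.
by exists x => n; have [] := xP n.
Qed.

Theorem theorem10 (R : realType) (k : scalar_kind)
    (E F : completeNormedModType (scalars R k)) :
  ~ schur_property (dual E) ->
  contains_copy_of_ell1 (dual F) ->
  (forall T : operator (dual E) (dual (dual F)), completely_continuous T) ->
  ~ dunford_pettis (dual (injective_tensor_product E F)).
Proof.
move=> /weakly_null_not_norm_null[phi phi0 phin0] /ell1_copy_sequence.
move=> [psi [M [d [d0 psiM psid]]]] Lcc DP.
have [x x1 phix] := norming_vectors phi.
have [L Ld Lpsi] := rademacher_coordinates d0 psid.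
pose S := coordinate_operator x1 d0 Ld.
pose u n := rank_one (phi n) (psi n).
have u0 (Xi : dual (dual (injective_tensor_product E F))) :
    (fun n => Xi (u n) : scalars R k) @ \oo --> (0 : scalars R k).
  exact: rank_one_weakly_null (Lcc _) phi0 psiM.
have uc : weakly_cauchy u by move=> Xi; apply: cvg_cauchy; apply: cvgP (u0 Xi).
have Sc := DP _ S (coordinate_operator_weakly_compact x1 d0 Ld) u uc.
(* Weak nullity of [u] makes every coordinate of [S (u n)] tend to 0, so a Cauchy
   sequence [S (u n)] would tend to 0 in norm, and with it [phi n (x n)]. *)
have S0 w : (fun n => S (u n) w : scalars R k) @ \oo --> (0 : scalars R k).
  by have := u0 (pairing S w).
apply: phin0 => e e0; have e20 : 0 < e / 2 by rewrite divr_gt0.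
have := cauchy_pointwise_null Sc S0 e20; apply: filterS => n hn.
apply: le_trans (phix n) _.
rewrite -(coordinate_rank_one x1 d0 Ld _ _ Lpsi) mulrC -ler_pdivlMr//.
apply: le_trans (rnorm_apply_le (S (u n)) _) _.
by rewrite rnorm_monomial mulr1.
Qed.
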